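(* Let $\mathfrak{g}$ be a finite-dimensional nilpotent Lie algebra over an algebraically closed field $k$ of characteristic zero with $i(\mathfrak{g})\leq 2$. Then $\mathfrak{g}$ is coregular.
   Context: The index is $i(\mathfrak{g})=\min_{\xi\in\mathfrak{g}^*}\dim\{x\in\mathfrak{g}\mid\xi([x,y])=0\text{ for all }y\in\mathfrak{g}\}$. $Y(\mathfrak{g})=S(\mathfrak{g})^{\mathfrak{g}}$ is the algebra of invariants of the adjoint action of $\mathfrak{g}$ on its symmetric algebra $S(\mathfrak{g})$. $\mathfrak{g}$ is coregular if $Y(\mathfrak{g})$ is a polynomial algebra over $k$. *)

(* Defs.v *)
From HB Require Import structures.
From mathcomp Require Import all_boot all_order all_algebra all_field.
From mathcomp Require Import boolp.
From mathcomp Require Import mpoly.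

Set Implicit Arguments.
Unset Strict Implicit.
Unset Printing Implicit Defensive.

Import GRing.Theory.
Local Open Scope ring_scope.

HB.mixin Record Vector_isLieAlgebra (K : fieldType) (L : Type)
    of Vector K L := {
  lie : L -> L -> L;
  lie_linearl : forall y, linear (fun x => lie x y);
  lie_linearr : forall x, linear (lie x);
  liexx : forall x, lie x x = 0;
  lie_jacobi : forall x y z,
    lie x (lie y z) + lie y (lie z x) + lie z (lie x y) = 0
}.

#[short(type="lieAlgType")]
HB.structure Definition LieAlgebra (K : fieldType) :=
  { L of Vector K L & Vector_isLieAlgebra K L }.

Notation "[ 'lie' x , y ]" := (lie x y)
  (at level 0, format "[ 'lie'  x ,  y ]") : ring_scope.

HB.instance Definition _ (K : fieldType) (L : lieAlgType K) (x : L) :=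
  GRing.isLinear.Build K L L *:%R (lie x) (lie_linearr x).

Section LieAlgebra.
Variables (K : fieldType) (L : lieAlgType K).
Implicit Types (x y z v : L) (U V : {vspace L}).

(* The linear span of all brackets of U with V; by bilinearity (memv_lie,
   lie_vspace_sub) it suffices to take brackets of basis vectors. *)
Definition lie_vspace U V : {vspace L} :=
  <<[seq [lie u, v] | u <- vbasis U, v <- vbasis V]>>%VS.

Lemma lieDl x y z : [lie x + y, z] = [lie x, z] + [lie y, z].
Proof. by have := lie_linearl z 1 x y; rewrite !scale1r. Qed.

Lemma lie0l z : [lie 0, z] = 0.
Proof. by apply: (addrI [lie 0, z]); rewrite -lieDl !addr0. Qed.

Lemma lieZl c x z : [lie c *: x, z] = c *: [lie x, z].
Proof. by have := lie_linearl z c x 0; rewrite lie0l !addr0. Qed.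

Lemma lieC x y : [lie x, y] = - [lie y, x].
Proof.
have := liexx (x + y); rewrite lieDl !linearD /= !liexx add0r addr0.
by move/eqP; rewrite addr_eq0 => /eqP.
Qed.

Lemma lie_suml I (r : seq I) (P : pred I) (F : I -> L) z :
  [lie \sum_(i <- r | P i) F i, z] = \sum_(i <- r | P i) [lie F i, z].
Proof.
by rewrite lieC linear_sum -sumrN; apply: eq_bigr => i _; rewrite -lieC.
Qed.

Lemma memv_lie U V u v : u \in U -> v \in V -> [lie u, v] \in lie_vspace U V.
Proof.
move=> /coord_vbasis-> /coord_vbasis->; rewrite lie_suml memv_suml // => i _.
rewrite lieZl memvZ // linear_sum memv_suml // => j _.
by rewrite linearZ memvZ // memv_span // allpairs_f ?memt_nth.
Qed.

Lemma lie_vspace_sub U V (W : {vspace L}) :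
  (forall u v, u \in U -> v \in V -> [lie u, v] \in W) ->
  (lie_vspace U V <= W)%VS.
Proof.
move=> sUVW; apply/span_subvP=> _ /allpairsP[[u v] [/= uU vV ->]].
by apply: sUVW; apply: vbasis_mem.
Qed.

Fixpoint lower_central (n : nat) : {vspace L} :=
  if n is n'.+1 then lie_vspace fullv (lower_central n') else fullv.

Definition lie_nilpotent : Prop := exists n, lower_central n = 0%VS.

(* K^o is K viewed as a vector space, so 'Hom(L, K^o) is the dual of L. *)
Definition lie_form (xi : 'Hom(L, K^o)) x : 'Hom(L, K^o) :=
  linfun (xi \o lie x).

Lemma lie_formE xi x y : lie_form xi x y = xi [lie x, y].
Proof. by rewrite lfunE. Qed.

Fact lie_form_linear xi : linear (lie_form xi).
Proof.
move=> c x y; apply/lfunP=> z.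
by rewrite add_lfunE scale_lfunE !lie_formE lieDl lieZl linearP.
Qed.

HB.instance Definition _ xi :=
  GRing.isLinear.Build K L 'Hom(L, K^o) *:%R (lie_form xi)
    (lie_form_linear xi).

Definition lie_stab (xi : 'Hom(L, K^o)) : {vspace L} :=
  lker (linfun (lie_form xi)).

Lemma lie_stabP (xi : 'Hom(L, K^o)) x :
  reflect (forall y, xi [lie x, y] = 0) (x \in lie_stab xi).
Proof.
rewrite memv_ker lfunE /=; apply: (iffP eqP) => [x0 y|x0].
  by rewrite -lie_formE x0 lfunE.
by apply/lfunP=> y; rewrite lie_formE x0 lfunE.
Qed.

Fact lie_index_subproof :
  exists d, `[< exists xi : 'Hom(L, K^o), \dim (lie_stab xi) = d >].
Proof. by exists (\dim (lie_stab 0)); apply/asboolP; exists 0. Qed.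

Definition lie_index : nat := ex_minn lie_index_subproof.

(* The symmetric algebra of L, as the polynomial algebra on the basis
   vbasis fullv; 'X_i stands for the i-th basis vector. See symalg_univ for
   the basis-independent characterization. *)
Local Notation symalg := {mpoly K[\dim {:L}]}.

Definition symalg_in x : symalg :=
  \sum_i coord (vbasis {:L}) i x *: 'X_i.

Fact symalg_in_linear : linear symalg_in.
Proof.
move=> c x y; rewrite /symalg_in scaler_sumr -big_split /=.
by apply: eq_bigr => i _; rewrite linearP scalerDl scalerA.
Qed.

HB.instance Definition _ :=
  GRing.isLinear.Build K L symalg *:%R symalg_in symalg_in_linear.

Lemma symalg_in_basis (i : 'I_(\dim {:L})) :
  symalg_in (vbasis {:L})`_i = 'X_i.
Proof.
rewrite /symalg_in (bigD1 i) //= big1 ?addr0 => [|j ji].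
  by rewrite coord_free ?eqxx ?scale1r ?(basis_free (vbasisP _)).
rewrite coord_free ?(basis_free (vbasisP _)) //.
by rewrite eq_sym (negbTE ji) scale0r.
Qed.

(* The adjoint action of x on symalg: the derivation which sends the basis
   vector 'X_i = symalg_in e_i to symalg_in [lie x, e_i]. *)
Definition symalg_ad x (p : symalg) : symalg :=
  \sum_(i < \dim {:L}) symalg_in [lie x, (vbasis {:L})`_i] * mderiv i p.

Lemma symalg_adM x (p q : symalg) :
  symalg_ad x (p * q) = symalg_ad x p * q + p * symalg_ad x q.
Proof.
rewrite /symalg_ad mulr_suml mulr_sumr -big_split /=; apply: eq_bigr => i _.
by rewrite mderivM mulrDr; congr (_ + _); [exact: mulrA | exact: mulrCA].
Qed.

Lemma symalg_ad_in x y : symalg_ad x (symalg_in y) = symalg_in [lie x, y].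
Proof.
rewrite [in RHS](coord_vbasis (memvf y)) !linear_sum /=; apply: eq_bigr => i _.
rewrite !linearZ /= -mulr_algr; congr (_ * _).
rewrite raddf_sum (bigD1 i) //= big1 ?addr0 => [|j ji].
  by rewrite mderivZ mderivX mnm1E eqxx scale1r -{1}[U_(i)%MM]add0m addmK mpolyX0.
by rewrite mderivZ mderivX mnm1E (negbTE ji) scale0r scaler0.
Qed.

Definition lie_invariant (p : symalg) : Prop := forall x, symalg_ad x p = 0.

(* symalg has finite transcendence degree over K, so a polynomial algebra
   embedded in it has finitely many variables. *)
Definition coregular : Prop :=
  exists (m : nat) (phi : {lrmorphism {mpoly K[m]} -> symalg}),
    injective phi /\
    forall p, lie_invariant p <-> exists q, phi q = p.

End LieAlgebra.

Notation symalg L := {mpoly _[\dim (fullv : {vspace L})]}.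

Theorem symalg_univ (K : fieldType) (L : lieAlgType K) (A : comAlgType K)
    (f : {linear L -> A}) :
  exists2 F : {lrmorphism symalg L -> A},
    forall x, F (symalg_in x) = f x
  & forall G : {lrmorphism symalg L -> A},
      (forall x, G (symalg_in x) = f x) -> G =1 F.
Proof.
pose e := vbasis {:L}.
pose h (i : 'I_(\dim {:L})) := f e`_i.
pose F := mmap (in_alg A) h.
have FZ : scalable F.
  by move=> c p; rewrite /F mmapZ /= mulr_algl.
pose FL := GRing.isScalable.Build K (symalg L) A *:%R F FZ.
pose FM : {lrmorphism symalg L -> A} := HB.pack F FL.
exists FM => [x|G Gf p].
  rewrite /symalg_in raddf_sum [in RHS](coord_vbasis (memvf x)).
  rewrite linear_sum; apply: eq_bigr => i _.
  by rewrite [LHS]FZ linearZ /= /F mmapX mmap1U.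
rewrite /=; elim/mpolyind: p => [|c m p _ _ IHp].
  by rewrite /F mmap0 raddf0.
rewrite [LHS]raddfD [RHS](raddfD FM) /=; congr (_ + _); last exact: IHp.
rewrite [LHS]linearZ [RHS](FZ c) /=; congr (_ *: _).
rewrite mpolyXE_id [LHS]rmorph_prod [RHS](rmorph_prod FM); apply: eq_bigr => i _.
rewrite [LHS]rmorphXn [RHS](rmorphXn FM) /=; congr (_ ^+ _).
by rewrite -symalg_in_basis Gf symalg_in_basis /F mmapX mmap1U.
Qed.

(* Main.v *)
Require Import Defs.
From HB Require Import structures.
From mathcomp Require Import all_boot all_order all_algebra all_field.
From mathcomp Require Import boolp.
From mathcomp Require Import mpoly.
From mathcomp Require Import ring.

(** Let z be a nonzero central element and xi a functional with xi(z) = 1 whose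
    stabilizer has dimension at most 2; it exists because both conditions are
    open and nonempty.  If the center is spanned by z, there
    are y in the second center, with xi(y) = 0, and x with [x, y] = z; on the
    subspace W' orthogonal to x and y for the form xi([u, v]), reducing the
    bracket modulo y gives a nilpotent Lie algebra with the same z and xi and no
    larger radical.  Reduction modulo y is injective on invariants, because
    ker (ad x) is factorially closed and does not contain y; and
    sum_k (-y)^k/k! z^(N-k) (ad x)^k(t) lifts z^N t for each invariant t.
    The recursion stops when W is spanned by z or the center contains some w
    outside <z>.  Then the radical is spanned by z and w (or z alone), and the
    nondegeneracy of the form modulo its radical forces every invariant into
    k[z, w].  Going back up, there is an invariant t such that every invariant
    lies in k[z, t] up to a power of z.

    If z divides t - c for a constant c, replace t by (t - c)/z.  This stops with
    t constant, where the invariants are k[z], or with t not congruent to a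
    constant modulo z.  In the latter case t is transcendental modulo z, so z
    and t are algebraically independent, and a relation z^l a = P(z, t) can be
    divided by z until l = 0: the invariants are k[z, t]. *)

Set Implicit Arguments.
Unset Strict Implicit.
Unset Printing Implicit Defensive.
Import GRing.Theory.
Local Open Scope ring_scope.

(** * Derivations and endomorphisms of the symmetric algebra *)

Section LocallyNilpotent.
Variables (R : idomainType) (D : {additive R -> R}).
Hypothesis DM : forall p q, D (p * q) = D p * q + p * D q.
Hypothesis nat_neq0 : forall n, n.+1%:R != 0 :> R.

Lemma iter_raddf0 n : iter n D 0 = 0.
Proof. by elim: n => //= n ->; exact: raddf0. Qed.

Lemma iter_raddfD n p q : iter n D (p + q) = iter n D p + iter n D q.
Proof. by elim: n => //= n ->; exact: raddfD. Qed.

Lemma iter_deriv_mull n p q : D p = 0 -> iter n D (p * q) = p * iter n D q.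
Proof. by move=> Dp; elim: n => //= n ->; rewrite DM Dp mul0r add0r. Qed.

(** Every other term of the Leibniz expansion contains [D^i p] with [i > m] or [D^j q] with
    [j > n]. *)
Lemma iter_deriv_topM m n p q : iter m.+1 D p = 0 -> iter n.+1 D q = 0 ->
  iter (m + n) D (p * q) = 'C(m + n, m)%:R * (iter m D p * iter n D q).
Proof.
move En: (m + n)%N => s; elim: s m n p q En => [|s IH] [|m] [|n] p q //= En.
- by rewrite bin0 mul1r.
- move=> Dp _; case: En => <-; rewrite bin0 mul1r -iterS.
  by rewrite iter_deriv_mull.
- move=> _ Dq; move: En; rewrite addn0 => -[<-].
  by rewrite binn mul1r -iterS mulrC iter_deriv_mull // mulrC.
rewrite -!iterS => Dp Dq; case: En => En.
rewrite iterSr DM iter_raddfD binS natrD mulrDl addrC.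
have -> : iter s D (p * D q) = 'C(s, m.+1)%:R * (iter m.+1 D p * iter n D (D q)).
  by apply: IH; rewrite -?iterSr // addSnnS.
have -> : iter s D (D p * q) = 'C(s, m)%:R * (iter m D (D p) * iter n.+1 D q).
  by apply: IH; rewrite -?iterSr.
by rewrite -!iterSr.
Qed.

Lemma iter_last n p : p != 0 -> iter n D p = 0 ->
  exists2 m, iter m D p != 0 & iter m.+1 D p = 0.
Proof.
elim: n => [|n IH] p0 /= Dn; first by rewrite Dn eqxx in p0.
by case: (eqVneq (iter n D p) 0) => [/(IH p0) //|]; exists n.
Qed.

(* If [m] and [n] are maximal with [D^m p] and [D^n q] nonzero, then
   [D^(m + n) (p * q)] is nonzero. *)
Lemma lnd_factor p q : (forall r, exists n, iter n D r = 0) ->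
  D (p * q) = 0 -> p != 0 -> q != 0 -> D p = 0.
Proof.
move=> lnd Dpq p0 q0.
have [m mp mp1] : exists2 m, iter m D p != 0 & iter m.+1 D p = 0.
  by have [n] := lnd p; exact: iter_last.
have [n nq nq1] : exists2 m, iter m D q != 0 & iter m.+1 D q = 0.
  by have [n] := lnd q; exact: iter_last.
case: m mp mp1 => // m mp mp1.
have := iter_deriv_topM mp1 nq1; rewrite addSn iterSr Dpq iter_raddf0.
move/esym/eqP; rewrite !mulf_eq0 (negbTE mp) (negbTE nq) !orbF.
have : (0 < 'C((m + n).+1, m.+1))%N by rewrite bin_gt0 ltnS leq_addr.
by case: 'C(_, _) => // c _; rewrite (negbTE (nat_neq0 _)).
Qed.

Lemma lnd_mul m n p q : iter m D p = 0 -> iter n D q = 0 ->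
  iter (m + n) D (p * q) = 0.
Proof.
move: p q; move Es: (m + n)%N => s; elim: s m n Es => [|s IH] m n Es p q mp nq.
  by move: Es mp; case: m => //= _ ->; rewrite mul0r.
rewrite iterSr DM iter_raddfD.
case: m Es mp => [|m] Es mp.
  by move: mp => /= ->; rewrite raddf0 !mul0r !iter_raddf0 addr0.
case: n Es nq => [|n] Es nq.
  by move: nq => /= ->; rewrite raddf0 !mulr0 !iter_raddf0 addr0.
rewrite (IH m n.+1) -?iterSr//; last by case: Es.
by rewrite (IH m.+1 n) -?iterSr ?addr0//; case: Es; rewrite addSnnS.
Qed.

Lemma lnd_add m n p q : iter m D p = 0 -> iter n D q = 0 ->
  iter (m + n) D (p + q) = 0.
Proof.
by move=> mp nq; rewrite iter_raddfD {1}addnC !iterD mp nq !iter_raddf0 addr0.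
Qed.

End LocallyNilpotent.

(** * Derivations and substitutions determined by their values on vectors *)

Section SymmetricAlgebra.
Variables (K : fieldType) (L : lieAlgType K).
Local Notation S := {mpoly K[\dim {:L}]}.
Local Notation e := (vbasis {:L}).
Local Notation sin := (@symalg_in K L).
Implicit Types (u v w x y z : L) (p q a : S) (F G : L -> S).
Implicit Types (f g : 'End(L)) (lam nu : 'Hom(L, K^o)) (W : {vspace L}).

Lemma symalg_in_inj : injective sin.
Proof.
move=> u v uv; rewrite (coord_vbasis (memvf u)) (coord_vbasis (memvf v)).
apply: eq_bigr => i _; congr (_ *: _).
have := congr1 (fun p : S => p@_U_(i)) uv.
have E w : (sin w)@_U_(i) = coord e i w.
  rewrite /symalg_in raddf_sum (bigD1 i) //= big1 ?addr0 => [|j ji].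
    by rewrite mcoeffZ mcoeffXU eqxx mulr1.
  by rewrite mcoeffZ mcoeffXU (negbTE ji) mulr0.
by rewrite !E.
Qed.

Lemma symalg_in_eq0 v : (sin v == 0) = (v == 0).
Proof. by rewrite -(inj_eq symalg_in_inj) linear0. Qed.

Lemma symalg_ind (P : S -> Prop) :
  (forall c, P c%:MP) -> (forall v, P (sin v)) ->
  (forall p q, P p -> P q -> P (p + q)) ->
  (forall p q, P p -> P q -> P (p * q)) -> forall p, P p.
Proof.
move=> PC Pv PD PM; elim/mpolyind => [|c m p _ _ IH]; first by rewrite -mpolyC0.
apply: PD => //; rewrite -mul_mpolyC; apply: (PM) => //.
rewrite mpolyXE_id; apply: big_ind => [||i _]; rewrite -?mpolyC1 //.
elim: (m i) => [|d IHd]; first by rewrite expr0 -mpolyC1.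
by rewrite exprS; apply: PM => //; rewrite -symalg_in_basis.
Qed.

(* For linear [F], the derivation of the symmetric algebra extending [F]. *)
Definition der F p : S := \sum_(i < \dim {:L}) F e`_i * mderiv i p.

Fact der_zmod_morphism F : zmod_morphism (der F).
Proof.
move=> p q; rewrite /der -sumrB; apply: eq_bigr => i _.
by rewrite mderivB mulrBr.
Qed.
HB.instance Definition _ F :=
  GRing.isZmodMorphism.Build S S (der F) (der_zmod_morphism F).

Lemma derM F p q : der F (p * q) = der F p * q + p * der F q.
Proof.
rewrite /der mulr_suml mulr_sumr -big_split /=; apply: eq_bigr => i _.
by rewrite mderivM mulrDr; congr (_ + _); [exact: mulrA | exact: mulrCA].
Qed.

Lemma derC F c : der F c%:MP = 0.
Proof. by rewrite /der big1 // => i _; rewrite mderivC mulr0. Qed.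

Lemma derZ F c p : der F (c *: p) = c *: der F p.
Proof. by rewrite -!mul_mpolyC derM derC mul0r add0r. Qed.

Lemma der_in F v : linear F -> der F (sin v) = F v.
Proof.
move=> linF; pose F' : {linear L -> S} :=
  HB.pack F (GRing.isLinear.Build K L S *:%R F linF).
rewrite [in RHS](coord_vbasis (memvf v)) [RHS](linear_sum F') /=.
apply: eq_bigr => i _; rewrite [RHS](linearZ_LR F') /= -mulr_algr; congr (_ * _).
rewrite raddf_sum (bigD1 i) //= big1 ?addr0 => [|j ji].
  by rewrite mderivZ mderivX mnm1E eqxx scale1r -{1}[U_(i)%MM]add0m addmK mpolyX0.
by rewrite mderivZ mderivX mnm1E (negbTE ji) scale0r scaler0.
Qed.

Lemma der_eq F G p : F =1 G -> der F p = der G p.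
Proof. by move=> FG; apply: eq_bigr => i _; rewrite FG. Qed.

Lemma derX F p n : der F (p ^+ n.+1) = n.+1%:R * p ^+ n * der F p.
Proof.
elim: n => [|n IH]; first by rewrite expr0 !mul1r expr1.
by rewrite exprS derM IH -(natr1 n.+1) !exprS; ring.
Qed.

Definition symalg_map f : S -> S :=
  mmap (@mpolyC _ K) (fun i : 'I_(\dim {:L}) => sin (f e`_i)).
HB.instance Definition _ f := GRing.RMorphism.on (symalg_map f).

Lemma symalg_mapC f c : symalg_map f c%:MP = c%:MP.
Proof. exact: mmapC. Qed.

Lemma symalg_mapZ f c p : symalg_map f (c *: p) = c *: symalg_map f p.
Proof. by rewrite -!mul_mpolyC rmorphM /= symalg_mapC. Qed.

Lemma symalg_map_in f v : symalg_map f (sin v) = sin (f v).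
Proof.
rewrite {1}/symalg_in rmorph_sum [in RHS](coord_vbasis (memvf v)) !linear_sum /=.
apply: eq_bigr => i _; rewrite symalg_mapZ !linearZ; congr (_ *: _).
by rewrite /symalg_map mmapX mmap1U.
Qed.

(** Both sides are derivations along the ring morphism [symalg_map f], so it suffices to compare
    them on vectors. *)
Lemma symalg_map_der f F G p : linear F -> linear G ->
  (forall v, G (f v) = symalg_map f (F v)) ->
  der G (symalg_map f p) = symalg_map f (der F p).
Proof.
move=> linF linG GF; elim/symalg_ind: p => [c|v|p q IHp IHq|p q IHp IHq].
- by rewrite symalg_mapC !derC rmorph0.
- by rewrite symalg_map_in !der_in.
- by rewrite !raddfD /= IHp IHq.
- by rewrite rmorphM !derM rmorphD !rmorphM /= IHp IHq.
Qed.

Lemma symalg_map_comp f g p :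
  symalg_map f (symalg_map g p) = symalg_map (f \o g)%VF p.
Proof.
elim/symalg_ind: p => [c|v|p q IHp IHq|p q IHp IHq].
- by rewrite !symalg_mapC.
- by rewrite !symalg_map_in comp_lfunE.
- by rewrite !rmorphD /= IHp IHq.
- by rewrite !rmorphM /= IHp IHq.
Qed.

Lemma symalg_map_id f p : f =1 id -> symalg_map f p = p.
Proof.
move=> fE; elim/symalg_ind: p => [c|v|p q IHp IHq|p q IHp IHq].
- by rewrite symalg_mapC.
- by rewrite symalg_map_in fE.
- by rewrite rmorphD /= IHp IHq.
- by rewrite rmorphM /= IHp IHq.
Qed.

(** A commutator of derivations is a derivation, hence determined by its values on vectors. *)
Lemma der_comm F G p : linear F -> linear G ->
  der F (der G p) - der G (der F p) =
  der (fun v => der F (G v) - der G (F v)) p.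
Proof.
move=> linF linG; elim/symalg_ind: p => [c|v|p q IHp IHq|p q IHp IHq].
- by rewrite !derC !raddf0 addr0.
- rewrite (der_in _ linF) (der_in _ linG) der_in // => c u v'.
  rewrite linF linG (raddfD (der F)) (raddfD (der G)) /= !derZ scalerBr.
  by rewrite opprD addrACA.
- rewrite !(raddfD (der F), raddfD (der G), raddfD (der (fun=> _))) /= -IHp -IHq.
  by rewrite opprD addrACA.
- rewrite !derM (raddfD (der F)) (raddfD (der G)) /= !derM -IHp -IHq; ring.
Qed.

(** Viewing the symmetric algebra as polynomial functions on the dual of [L], [der (cst lam)] is the
    directional derivative along [lam]. *)
Definition cst lam v : S := (lam v : K)%:MP.

Fact cst_linear lam : linear (cst lam).
Proof. by move=> c u v; rewrite /cst linearP mpolyCD mpolyCM -mul_mpolyC. Qed.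

Definition lin f v : S := sin (f v).

Fact lin_linear f : linear (lin f).
Proof. by move=> c u v; rewrite /lin !linearP. Qed.

Lemma der_cst_in lam v : der (cst lam) (sin v) = (lam v : K)%:MP.
Proof. exact/der_in/cst_linear. Qed.

Lemma der_lin_in f v : der (lin f) (sin v) = sin (f v).
Proof. exact/der_in/lin_linear. Qed.

(* [symS W p] says that [p] lies in the subalgebra generated by [W]. *)
Definition symS W p :=
  forall lam, {in W, forall w, lam w = 0} -> der (cst lam) p = 0.

Lemma symS_full p : symS fullv p.
Proof.
move=> lam lam0; rewrite (@der_eq _ (fun => 0)).
  by rewrite /der big1 // => i _; rewrite mul0r.
by move=> v; rewrite /cst lam0 ?memvf ?mpolyC0.
Qed.

Lemma symSC W c : symS W c%:MP.
Proof. by move=> lam _; rewrite derC. Qed.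

Lemma symS_in W w : w \in W -> symS W (sin w).
Proof. by move=> wW lam lam0; rewrite der_cst_in lam0 ?mpolyC0. Qed.

Lemma symSD W p q : symS W p -> symS W q -> symS W (p + q).
Proof. by move=> Wp Wq lam H; rewrite raddfD /= Wp ?Wq ?addr0. Qed.

Lemma symSM W p q : symS W p -> symS W q -> symS W (p * q).
Proof. by move=> Wp Wq lam H; rewrite derM Wp ?Wq // mulr0 mul0r addr0. Qed.

Lemma symSX W p n : symS W p -> symS W (p ^+ n).
Proof.
move=> Wp; elim: n => [|n IH]; first by rewrite expr0 -mpolyC1; exact: symSC.
by rewrite exprS; exact: symSM.
Qed.

Lemma symS_sub W W' p : (W <= W')%VS -> symS W p -> symS W' p.
Proof. by move=> /subvP sub Wp lam H; apply: Wp => w /sub /H. Qed.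

(** The difference [H] of [F] and [G] vanishes on [W], so it is a combination, with coefficients in
    the symmetric algebra, of functionals [kap i] vanishing on [W]; each [der (cst (kap i))] kills
    [p]. *)
Lemma der_eqW W F G p : linear F -> linear G -> symS W p ->
  {in W, F =1 G} -> der F p = der G p.
Proof.
move=> linF linG Wp FG.
pose H v := F v - G v.
have linH : linear H.
  by move=> c u v; rewrite /H linF linG scalerBr opprD addrACA.
pose H' : {linear L -> S} := HB.pack H (GRing.isLinear.Build K L S *:%R H linH).
pose kap i : 'Hom(L, K^o) :=
  (linfun (coord e i : L -> K^o) \o (\1 - projv W))%VF.
have HE v : H v = \sum_i cst (kap i) v * H e`_i.
  have -> : H v = H (v - projv W v).
    rewrite -[H]/(H' : _ -> _) linearB /= [X in _ - X]/H FG ?memv_proj //.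
    by rewrite subrr subr0.
  rewrite [in LHS](coord_vbasis (memvf (v - projv W v))) -[H]/(H' : _ -> _).
  rewrite linear_sum; apply: eq_bigr => i _; rewrite linearZ /cst mul_mpolyC.
  by rewrite comp_lfunE lfunE add_lfunE opp_lfunE id_lfunE.
suff : der H p = 0.
  move=> H0; apply/eqP; rewrite -subr_eq0 -H0 /der -sumrB; apply/eqP.
  by apply: eq_bigr => i _; rewrite /H mulrBl.
rewrite /der.
under eq_bigr do rewrite HE mulr_suml.
rewrite exchange_big big1 // => j _.
have -> : \sum_(i < \dim {:L}) cst (kap j) e`_i * H e`_j * p^`M(i)
          = H e`_j * der (cst (kap j)) p.
  by rewrite /der mulr_sumr; apply: eq_bigr => i _; rewrite mulrAC mulrC.
rewrite Wp ?mulr0 // => w wW.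
by rewrite comp_lfunE add_lfunE opp_lfunE id_lfunE projv_id // subrr linear0.
Qed.

(** The commutator of [der (cst lam)] and [der (lin f)] is [der (cst (lam \o f))], and [lam \o f]
    vanishes on [W] as well. *)
Lemma symS_der W f p : {in W, forall w, f w \in W} -> symS W p ->
  symS W (der (lin f) p).
Proof.
move=> fW Wp lam lam0.
have := der_comm p (cst_linear lam) (lin_linear f).
rewrite (Wp _ lam0) raddf0 subr0 => ->.
rewrite (der_eq _ (G := cst (lam \o f)%VF)) => [|v]; last first.
  by rewrite /= {1}/lin der_cst_in /cst derC subr0 comp_lfunE.
by apply: Wp => w wW; rewrite comp_lfunE lam0 ?fW.
Qed.

(* [symalg_map f] reduces modulo the ideal generated by [y] when [f] moves
   every vector along [y]. *)
Lemma symalg_map_mod f mu y p : (forall v, f v = v - mu v *: y) ->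
  exists q, p = symalg_map f p + sin y * q.
Proof.
move=> fE; elim/symalg_ind: p => [c|v|p q [p' Hp] [q' Hq]|p q [p' Hp] [q' Hq]].
- by exists 0; rewrite symalg_mapC mulr0 addr0.
- exists (mu v : K)%:MP; rewrite symalg_map_in fE linearB linearZ /=.
  by rewrite mulrC mul_mpolyC subrK.
- by exists (p' + q'); rewrite {1}Hp {1}Hq rmorphD /=; ring.
- exists (p' * symalg_map f q + p * q').
  by rewrite {1}Hq rmorphM /= {1 3}Hp; ring.
Qed.

Hypothesis char0 : [pchar K] =i pred0.

Lemma natS_neq0 n : n.+1%:R != 0 :> K.
Proof. by rewrite (iffLR (pcharf0P K) char0). Qed.

Lemma natS_neq0_mpoly n : n.+1%:R != 0 :> S.
Proof. by rewrite -mpolyC_nat mpolyC_eq0 natS_neq0. Qed.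

Lemma der_lnd F : (forall v, exists n, iter n (der F) (sin v) = 0) ->
  forall p, exists n, iter n (der F) p = 0.
Proof.
move=> nilF; elim/symalg_ind => [c|//|p q [m mp] [n nq]|p q [m mp] [n nq]].
- by exists 1%N; rewrite /= derC.
- by exists (m + n)%N; apply: lnd_add.
- by exists (m + n)%N; apply: lnd_mul => //; exact: derM.
Qed.

Lemma der_factor F p q : (forall v, exists n, iter n (der F) (sin v) = 0) ->
  der F (p * q) = 0 -> p != 0 -> q != 0 -> der F p = 0.
Proof.
by move=> nilF; apply: lnd_factor; [exact: derM|exact: natS_neq0_mpoly|exact: der_lnd].
Qed.

Lemma iter_der_lin f n v : iter n (der (lin f)) (sin v) = sin (iter n f v).
Proof. by elim: n => //= n ->; rewrite der_lin_in. Qed.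

(** The difference of [p] and its image is a multiple [x q], killed by the locally nilpotent
    derivation [der (cst lam)]. The kernel of this derivation is factorially closed and does not
    contain [x], so [q = 0]. *)
Lemma symalg_map_fix f lam x p : lam x = 1 -> der (cst lam) p = 0 ->
  (forall v, f v = v - (lam v : K) *: x) -> symalg_map f p = p.
Proof.
move=> lx lp fE; have [q pE] := symalg_map_mod p fE.
case: (eqVneq q 0) => [q0|q0]; first by rewrite {2}pE q0 mulr0 addr0.
have lam0 : der (cst lam) (symalg_map f p) = 0.
  rewrite (@symalg_map_der f (fun => 0)).
  - by rewrite [X in symalg_map f X]big1 ?raddf0 // => i _; rewrite mul0r.
  - by move=> c u v; rewrite scaler0 addr0.
  - exact: cst_linear.
  - move=> v; rewrite raddf0 /cst fE linearB linearZ /= lx.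
    by rewrite /GRing.scale /= mulr1 subrr mpolyC0.
have x0 : sin x != 0.
  by rewrite symalg_in_eq0; apply: contra_eq_neq lx => ->; rewrite linear0 eq_sym oner_neq0.
have : der (cst lam) (sin x) = 0.
  apply: (der_factor (q := q)) => //.
    by move=> v; exists 2%N; rewrite /= der_cst_in derC.
  by rewrite -[LHS]add0r -{1}lam0 -raddfD -pE.
by rewrite der_cst_in lx => /eqP; rewrite mpolyC_eq0 oner_eq0.
Qed.

End SymmetricAlgebra.

(** * Brackets on subspaces *)

Section Subalgebra.
Variables (K : fieldType) (n : nat).
Local Notation S := {mpoly K[n]}.
Implicit Types (z t a b : S).

Definition gen2 z t : {mpoly K[2]} -> S :=
  mmap (@mpolyC _ K) (fun i => if i == ord0 then z else t).
HB.instance Definition _ z t := GRing.RMorphism.on (gen2 z t).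

Lemma gen2C z t c : gen2 z t c%:MP = c%:MP. Proof. exact: mmapC. Qed.
Lemma gen2X0 z t : gen2 z t 'X_ord0 = z.
Proof. by rewrite /gen2 mmapX mmap1U. Qed.
Lemma gen2X1 z t : gen2 z t 'X_ord_max = t.
Proof. by rewrite /gen2 mmapX mmap1U. Qed.

Definition alg z t a := exists P, gen2 z t P = a.

Lemma alg_const z t c : alg z t c%:MP. Proof. by exists c%:MP; exact: gen2C. Qed.
Lemma alg_l z t : alg z t z. Proof. by exists 'X_ord0; exact: gen2X0. Qed.
Lemma alg_r z t : alg z t t. Proof. by exists 'X_ord_max; exact: gen2X1. Qed.
Lemma algD z t a b : alg z t a -> alg z t b -> alg z t (a + b).
Proof. by move=> [P <-] [Q <-]; exists (P + Q); rewrite rmorphD. Qed.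
Lemma algM z t a b : alg z t a -> alg z t b -> alg z t (a * b).
Proof. by move=> [P <-] [Q <-]; exists (P * Q); rewrite rmorphM. Qed.
Lemma algX z t a m : alg z t a -> alg z t (a ^+ m).
Proof.
move=> Pa; elim: m => [|m IH]; first by rewrite expr0 -mpolyC1; exact: alg_const.
by rewrite exprS; exact: algM.
Qed.

Lemma alg_ind z t (P : S -> Prop) :
  (forall c, P c%:MP) -> P z -> P t ->
  (forall a b, P a -> P b -> P (a + b)) ->
  (forall a b, P a -> P b -> P (a * b)) -> forall a, alg z t a -> P a.
Proof.
move=> PC Pz Pt PD PM _ [Q <-]; elim/mpolyind: Q => [|c m p _ _ IH].
  by rewrite raddf0 -mpolyC0.
rewrite rmorphD; apply: (PD) => //; rewrite -mul_mpolyC rmorphM /= gen2C.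
apply: (PM) => //; rewrite mpolyXE_id rmorph_prod.
apply: big_ind => [||i _] /=; rewrite -?mpolyC1 //.
rewrite rmorphXn /= {1}/gen2 mmapX mmap1U.
elim: (m i) => [|d IHd]; first by rewrite expr0 -mpolyC1.
by rewrite exprS; apply: PM => //; case: ifP.
Qed.

(* Membership in the localization of the subalgebra at [z]. *)
Definition loc z t a := exists m, alg z t (z ^+ m * a).

Lemma alg_loc z t a : alg z t a -> loc z t a.
Proof. by exists 0%N; rewrite expr0 mul1r. Qed.

Lemma locD z t a b : loc z t a -> loc z t b -> loc z t (a + b).
Proof.
move=> [m Pa] [l Pb]; exists (m + l)%N; rewrite mulrDr {1}addnC !exprD -!mulrA.
by apply: algD; apply: algM => //; apply: algX; exact: alg_l.
Qed.

Lemma locM z t a b : loc z t a -> loc z t b -> loc z t (a * b).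
Proof.
move=> [m Pa] [l Pb]; exists (m + l)%N; rewrite exprD mulrACA.
exact: algM.
Qed.

Lemma loc_trans z t t' a : loc z t' t -> loc z t a -> loc z t' a.
Proof.
move=> tt' [m Pa].
have [l Pl] : loc z t' (z ^+ m * a).
  apply: alg_ind Pa => //; [|by apply: alg_loc; exact: alg_l|exact: locD|exact: locM].
  by move=> c; apply: alg_loc; exact: alg_const.
by exists (l + m)%N; rewrite exprD -mulrA.
Qed.

End Subalgebra.

(** * Bracket data, invariants and the base case of the recursion *)

Section Brackets.
Variables (K : fieldType) (L : lieAlgType K).
Hypothesis char0 : [pchar K] =i pred0.
Local Notation S := {mpoly K[\dim {:L}]}.
Local Notation e := (vbasis {:L}).
Local Notation sin := (@symalg_in K L).
Implicit Types (u v w x y z : L) (p q a : S) (f g : 'End(L)).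
Implicit Types (lam mu xi : 'Hom(L, K^o)) (W Rd : {vspace L}) (br : L -> 'End(L)).

Definition scal lam x v : L := (lam v : K) *: x.
Fact scal_linear lam x : linear (scal lam x).
Proof. by move=> c u v; rewrite /scal linearP scalerDl scalerA. Qed.
HB.instance Definition _ lam x :=
  GRing.isLinear.Build K L L *:%R (scal lam x) (scal_linear lam x).

(** In every use [lam x = 1], so this is the projection onto the kernel of [lam] along [x]. *)
Definition shear lam x : 'End(L) := \1%VF - linfun (scal lam x).
Lemma shearE lam x v : shear lam x v = v - (lam v : K) *: x.
Proof. by rewrite add_lfunE opp_lfunE id_lfunE lfunE. Qed.

Definition coordf n (X : n.-tuple L) i f : 'Hom(L, K^o) :=
  (linfun (coord X i : L -> K^o) \o f)%VF.
Lemma coordfE n (X : n.-tuple L) i f v : coordf X i f v = coord X i (f v).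
Proof. by rewrite comp_lfunE lfunE. Qed.

Lemma addv_pi1_eq0 W Rd v : v \in Rd -> addv_pi1 W Rd v = 0.
Proof.
move=> vR; have vWR : v \in (W + Rd)%VS by rewrite -[v]add0r memv_add ?mem0v.
by have := addv_pi1_pi2 vWR; rewrite addv_pi2_id // => /(canRL (addrK _)); rewrite subrr.
Qed.

(** This recovers generation by [W] from the differential condition [symS]: a projection onto [W] is
    a product of shears along a basis of a complement, and each shear fixes [a] by
    [symalg_map_fix]. *)
Lemma symS_map W a : symS W a ->
  exists2 f, symalg_map f a = a & forall v, f v \in W.
Proof.
move=> Wa; set C := ({:L} :\: W)%VS; set c := vbasis C.
pose ga i := coordf c i (addv_pi1 {:L} W).
have gaW i : {in W, forall w, ga i w = 0}.
  by move=> w wW; rewrite coordfE addv_pi1_eq0 // linear0.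
have gac i (j : 'I_(\dim C)) : ga i c`_j = (i == j)%:R.
  have cC : c`_j \in C by rewrite vbasis_mem // mem_nth ?size_tuple.
  rewrite coordfE daddv_pi_id ?capv_diff // coord_free ?(basis_free (vbasisP _)) //.
  by rewrite eq_sym.
pose F (s : seq 'I_(\dim C)) :=
  foldr (fun i f => (shear (ga i) c`_i \o f)%VF) \1%VF s.
have FE s v : uniq s -> F s v = v - \sum_(i <- s) (ga i v : K) *: c`_i.
  elim: s => [_|i s IH /= /andP[is_ us]]; first by rewrite big_nil id_lfunE subr0.
  rewrite comp_lfunE shearE IH // big_cons.
  have -> : ga i (v - \sum_(j <- s) (ga j v : K) *: c`_j) = ga i v.
    rewrite linearB linear_sum /= big_seq big1 ?subr0 // => j js.
    rewrite linearZ /= gac; case: eqP => [ij|]; last by rewrite scaler0.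
    by rewrite ij js in is_.
  by rewrite addrAC opprD addrA.
exists (F (index_enum 'I_(\dim C))) => [|v].
  elim: (index_enum _) => [|i s IH] /=; first by apply: symalg_map_id => v; rewrite id_lfunE.
  rewrite -symalg_map_comp IH; apply: (symalg_map_fix char0 (lam := ga i) (x := c`_i)).
  - by rewrite gac eqxx.
  - exact: Wa.
  - exact: shearE.
rewrite FE ?index_enum_uniq //.
have vWC : v \in ({:L} + W)%VS by rewrite addvC -[v]add0r memv_add ?mem0v ?memvf.
have -> : \sum_i (ga i v : K) *: c`_i = addv_pi1 {:L} W v.
  rewrite [RHS](coord_vbasis (memv_pi C W v)).
  by apply: eq_bigr => i _; rewrite coordfE.
rewrite -{1}(addv_pi1_pi2 vWC) addrAC subrr add0r; exact: memv_pi2.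
Qed.

Lemma symS_span2 z w a : symS (<[z]> + <[w]>)%VS a -> alg (sin z) (sin w) a.
Proof.
move=> /symS_map[f <- fR]; elim/symalg_ind: a => [c|v|p q Hp Hq|p q Hp Hq].
- by rewrite symalg_mapC; exact: alg_const.
- rewrite symalg_map_in.
  have /memv_addP[_ /vlineP[b ->] [_ /vlineP[c ->] ->]] := fR v.
  rewrite linearD !linearZ /= -!mul_mpolyC; apply: algD; apply: algM;
    by [exact: alg_const|exact: alg_l|exact: alg_r].
- by rewrite rmorphD; exact: algD.
- by rewrite rmorphM; exact: algM.
Qed.

Definition invar W br a :=
  symS W a /\ {in W, forall u, der (lin (br u)) a = 0}.

Lemma invar_alg W br (s t a : S) : invar W br s -> invar W br t -> alg s t a -> invar W br a.
Proof.
move=> iz it; apply: alg_ind => // [c|p q [p1 p2] [q1 q2]|p q [p1 p2] [q1 q2]].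
- by split=> [|u _]; [exact: symSC|rewrite derC].
- split=> [|u uW]; first exact: symSD.
  by rewrite raddfD /= p2 ?q2 ?addr0.
- split=> [|u uW]; first exact: symSM.
  by rewrite derM p2 ?q2 ?mul0r ?mulr0 ?addr0.
Qed.

(* [br] is a Lie bracket on [W] only: outside [W] the Jacobi identity may fail.
   Keeping [br] defined on all of [L] lets every stage of the recursion live in
   the same symmetric algebra. [Rd] bounds the radical of [xi (br u v)] on [W]. *)
Record lie_data W br xi z Rd : Prop := LieData {
  br_linear : linear br;
  br_alt : forall u, br u u = 0;
  br_stab : {in W &, forall u v, br u v \in W};
  br_jacobi : {in W & W & W, forall u v w,
    br (br u v) w = br u (br v w) - br v (br u w)};
  br_nilp : exists m, forall us v, size us = m.+1 -> {subset us <= W} ->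
    foldr (fun u w => br u w) v us = 0;
  z_mem : z \in W;
  z_central : {in W, forall u, br u z = 0};
  xi_z : xi z = 1;
  br_rad : {in W, forall u, {in W, forall v, xi (br u v) = 0} -> u \in Rd}
}.

Section Data.
Variables (W : {vspace L}) (br : L -> 'End(L)) (xi : 'Hom(L, K^o)) (z : L).
Variable (Rd : {vspace L}).
Hypothesis H : lie_data W br xi z Rd.
Local Notation ad u := (der (lin (br u))).

Lemma brDl u v w : br (u + v) w = br u w + br v w.
Proof. by have := br_linear H 1 u v; rewrite !scale1r => ->; rewrite add_lfunE. Qed.

Lemma br0l w : br 0 w = 0.
Proof. by apply: (addrI (br 0 w)); rewrite -brDl !addr0. Qed.

Lemma brZl c u w : br (c *: u) w = c *: br u w.
Proof.
have := br_linear H c u 0; rewrite addr0 => ->.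
by rewrite add_lfunE scale_lfunE br0l addr0.
Qed.

Lemma br_skew u v : br u v = - br v u.
Proof.
have := br_alt H (u + v); rewrite brDl !linearD /= !(br_alt H) add0r addr0.
by move/eqP; rewrite addr_eq0 => /eqP.
Qed.

Lemma brBl u v w : br (u - v) w = br u w - br v w.
Proof. by rewrite brDl -scaleN1r brZl scaleN1r. Qed.

Lemma br_suml I (r : seq I) (P : pred I) (F : I -> L) w :
  br (\sum_(i <- r | P i) F i) w = \sum_(i <- r | P i) br (F i) w.
Proof.
by rewrite br_skew linear_sum -sumrN; apply: eq_bigr => i _; rewrite -br_skew.
Qed.

Lemma adD u v a : ad (u + v) a = ad u a + ad v a.
Proof.
rewrite /der -big_split; apply: eq_bigr => i _.
by rewrite /lin brDl linearD mulrDl.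
Qed.

Lemma adZ c u a : ad (c *: u) a = c *: ad u a.
Proof.
rewrite /der scaler_sumr; apply: eq_bigr => i _.
by rewrite /lin brZl linearZ scalerAl.
Qed.

(** The Jacobi identity holds on [W] only, so the two derivations are compared through [der_eqW]. *)
Lemma ad_comm u v a : u \in W -> v \in W -> symS W a ->
  ad u (ad v a) = ad v (ad u a) + ad (br u v) a.
Proof.
move=> uW vW Wa; apply/eqP; rewrite addrC -subr_eq; apply/eqP.
rewrite der_comm; try exact: lin_linear.
apply: (der_eqW _ _ Wa); last 1 first.
- by move=> w wW; rewrite /lin !der_lin_in (br_jacobi H) // linearB.
- move=> c w w1; rewrite /lin !der_lin_in scalerBr !(linearD, linearZ) /=.
  by rewrite addrACA.
- exact: lin_linear.
Qed.

Lemma z_neq0 : z != 0.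
Proof.
by apply/eqP => z0; have := xi_z H; rewrite z0 linear0 => /esym/eqP; rewrite oner_eq0.
Qed.

(** The vector [v] ranges over all of [L], as it does in [br_nilp]; hence [ad u] is locally
    nilpotent on the whole symmetric algebra, as [der_factor] requires. *)
Lemma br_nil u : u \in W -> exists n, forall v, iter n (br u) v = 0.
Proof.
move=> uW; have [m nilm] := br_nilp H; exists m.+1 => v.
rewrite -(nilm (nseq m.+1 u) v) ?size_nseq //; last by move=> w /nseqP[->].
by elim: m.+1 => //= n ->.
Qed.

Lemma ad_lnd u : u \in W -> forall v, exists n, iter n (ad u) (sin v) = 0.
Proof.
move=> /br_nil[n nn] v; exists n.
by rewrite iter_der_lin nn linear0.
Qed.

Lemma invar_z : invar W br (sin z).
Proof.
split=> [|u uW]; first exact/symS_in/(z_mem H).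
by rewrite der_lin_in (z_central H) // linear0.
Qed.

Lemma invar_center w : w \in W -> {in W, forall u, br u w = 0} -> invar W br (sin w).
Proof.
move=> wW wc; split=> [|u uW]; first exact/symS_in.
by rewrite der_lin_in wc // linear0.
Qed.

(** Let [c] be a basis of a complement of [R] in [W]. Invariance of [a] under the [c_i] is a linear
    system in the derivatives of [a] along the dual functionals [ga j]. Its matrix is nonsingular
    because the form of [xi] is nondegenerate modulo [R], so [a] involves [R] only. *)
Lemma invar_base w : w \in W -> {in W, forall u, br u w = 0} ->
  {in W, forall u, {in W, forall v, xi (br u v) = 0} -> u \in (<[z]> + <[w]>)%VS} ->
  forall a, invar W br a -> alg (sin z) (sin w) a.
Proof.
move=> wW wc rad a [Wa inva]; apply: symS_span2.
set R := (<[z]> + <[w]>)%VS.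
have RW : (R <= W)%VS by rewrite subv_add -!memvE wW (z_mem H).
have Rc u v : u \in W -> v \in R -> br u v = 0.
  move=> uW /memv_addP[_ /vlineP[b ->] [_ /vlineP[c ->] ->]].
  by rewrite linearD !linearZ /= wc ?(z_central H) // !scaler0 addr0.
set C := (W :\: R)%VS; set c := vbasis C.
have CW : (C <= W)%VS by exact: diffvSl.
have cC i : c`_i \in C.
  have [ir|ir] := ltnP i (\dim C); first by rewrite vbasis_mem // mem_nth ?size_tuple.
  by rewrite nth_default ?mem0v // size_tuple.
have cW i : c`_i \in W by exact: (subvP CW).
pose ga i := coordf c i (addv_pi1 W R).
have gaE v : v \in W ->
    v = \sum_i (ga i v : K) *: c`_i + addv_pi2 W R v.
  move=> vW; have vWR : v \in (W + R)%VS by rewrite -[v]addr0 memv_add ?mem0v.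
  rewrite -{1}(addv_pi1_pi2 vWR); congr (_ + _).
  rewrite [LHS](coord_vbasis (memv_pi C R v)).
  by apply: eq_bigr => i _; rewrite coordfE.
have brE u v : u \in W -> v \in W -> br u v = \sum_i (ga i v : K) *: br u c`_i.
  move=> uW vW; rewrite {1}(gaE v vW) linearD /= (Rc u _ uW (memv_pi2 _ _ _)) addr0.
  by rewrite linear_sum; apply: eq_bigr => i _; rewrite linearZ.
pose M : 'M[S]_(\dim C) := \matrix_(i, j) sin (br c`_i c`_j).
(* Evaluation at the point [xi] of the dual turns [M] into the Gram matrix of the form, so [\det M]
   is nonzero as soon as that matrix is nonsingular. *)
pose ev := meval (fun i : 'I_(\dim {:L}) => xi e`_i : K).
have evE v : ev (sin v) = xi v.
  rewrite /ev /symalg_in raddf_sum [in RHS](coord_vbasis (memvf v)) linear_sum.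
  by apply: eq_bigr => i _; rewrite /= mevalZ mevalXU linearZ.
have detM : \det M != 0.
  apply: contraNneq (oner_neq0 K) => detM.
  have /eqP/det0P[v v0 vN] : \det (map_mx ev M) = 0 by rewrite det_map_mx detM raddf0.
  pose cv := \sum_i v 0 i *: c`_i.
  have cvC : cv \in C by apply: memv_suml => i _; exact: memvZ.
  have cvR : cv \in R.
    apply: rad => [|u uW]; first exact: (subvP CW).
    rewrite brE // ?(subvP CW) // linear_sum big1 // => j _.
    rewrite linearZ /= br_suml linear_sum /=.
    have := congr1 (fun A : 'rV_ _ => A 0 j) vN; rewrite !mxE => vNj.
    rewrite (_ : \sum_i _ = 0 :> K^o) ?scaler0 // -[RHS]vNj.
    by apply: eq_bigr => i _; rewrite brZl linearZ /= !mxE evE.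
  have /eqP cv0 : cv == 0.
    by rewrite -memv0 -(capv_diff W R) memv_cap cvC.
  case/eqP: v0; apply/rowP => i; rewrite mxE.
  by have /freeP := basis_free (vbasisP C); apply.
pose g : 'cV[S]_(\dim C) := \col_j der (cst (ga j)) a.
have der_sum (s : 'I_(\dim C) -> S) :
    der (fun v => \sum_i cst (ga i) v * s i) a = \sum_i s i * der (cst (ga i)) a.
  rewrite /der; under eq_bigr do rewrite mulr_suml.
  rewrite exchange_big; apply: eq_bigr => i _ /=.
  by rewrite mulr_sumr; apply: eq_bigr => j _; rewrite mulrAC mulrC.
have lin_sum (s : 'I_(\dim C) -> S) : linear (fun v => \sum_i cst (ga i) v * s i).
  move=> b u v; rewrite scaler_sumr -big_split; apply: eq_bigr => i _ /=.
  by rewrite cst_linear mulrDl scalerAl.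
have Mg : M *m g = 0.
  apply/colP => i; rewrite !mxE -[RHS](inva _ (cW i)).
  under eq_bigr do rewrite !mxE.
  rewrite -der_sum; apply: (der_eqW _ _ Wa) => //; first exact: lin_linear.
  move=> v vW; rewrite /lin brE // linear_sum; apply: eq_bigr => j _.
  by rewrite linearZ /= /cst mul_mpolyC.
(* Multiplying by the adjugate avoids inverting [M] over a ring that is only a domain. *)
have g0 j : der (cst (ga j)) a = 0.
  have : \adj M *m (M *m g) = 0 by rewrite Mg mulmx0.
  rewrite mulmxA mul_adj_mx mul_scalar_mx => /colP/(_ j); rewrite !mxE => /eqP.
  by rewrite mulf_eq0 (negbTE detM) => /eqP.
move=> lam lamR.
rewrite (der_eqW (G := fun v => \sum_i cst (ga i) v * (lam c`_i : K)%:MP) _ _ Wa).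
- by rewrite der_sum big1 // => i _; rewrite g0 mulr0.
- exact: cst_linear.
- exact: lin_sum.
move=> v vW; rewrite /cst {1}(gaE v vW) linearD /= (lamR _ (memv_pi2 _ _ _)) addr0.
rewrite linear_sum raddf_sum; apply: eq_bigr => i _.
by rewrite linearZ /= -mpolyCM.
Qed.

End Data.
End Brackets.

(** * Reduction modulo an element of the second center *)

Section Reduction.
Variables (K : fieldType) (L : lieAlgType K).
Hypothesis char0 : [pchar K] =i pred0.
Local Notation S := {mpoly K[\dim {:L}]}.
Local Notation e := (vbasis {:L}).
Local Notation sin := (@symalg_in K L).
Implicit Types (u v w : L) (p q a : S) (nu : 'Hom(L, K^o)).

Section Step.
Variables (W : {vspace L}) (br : L -> 'End(L)) (xi : 'Hom(L, K^o)) (z : L).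
Variable (Rd : {vspace L}).
Hypothesis H : lie_data W br xi z Rd.
Variables (x y : L).
Hypotheses (xW : x \in W) (yW : y \in W) (xi_y : xi y = 0) (br_xy : br x y = z).
Hypothesis br_y : {in W, forall u, br u y = (xi (br u y) : K) *: z}.
Local Notation ad u := (der (lin (br u))).

(** For the form [xi (br u v)], [lam] is the pairing with [y] on the right and [mu] the pairing with
    [x] on the left; [x] and [y] form a hyperbolic pair. The map [f] kills [y] and represents
    classes modulo [y] by elements of the kernel of [mu]. *)
Let lam : 'Hom(L, K^o) := (- (xi \o br y))%VF.
Let mu : 'Hom(L, K^o) := (xi \o br x)%VF.
Let f := shear mu y.
Let W' := (W :&: lker lam :&: lker mu)%VS.
Let br' u : 'End(L) := (f \o br u)%VF.

Let lamE u : lam u = xi (br u y).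
Proof. by rewrite opp_lfunE comp_lfunE (br_skew H y u) (linearN xi) opprK. Qed.
Let muE u : mu u = xi (br x u). Proof. by rewrite comp_lfunE. Qed.
Let fE v : f v = v - (mu v : K) *: y. Proof. exact: shearE. Qed.
Let mu_y : mu y = 1. Proof. by rewrite muE br_xy (xi_z H). Qed.
Let mu_z : mu z = 0. Proof. by rewrite muE (z_central H) // linear0. Qed.
Let lam_y : lam y = 0. Proof. by rewrite lamE (br_alt H) linear0. Qed.
Let lam_x : lam x = 1. Proof. by rewrite lamE br_xy (xi_z H). Qed.
Let lam_z : lam z = 0.
Proof. by rewrite lamE (br_skew H) (z_central H) // oppr0 linear0. Qed.
Let f_y : f y = 0. Proof. by rewrite fE mu_y scale1r subrr. Qed.
Let f_z : f z = z. Proof. by rewrite fE mu_z scale0r subr0. Qed.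
Let xi_f v : xi (f v) = xi v.
Proof. by rewrite fE linearB linearZ /= xi_y scaler0 subr0. Qed.

Let memW' v : (v \in W') = [&& v \in W, lam v == 0 & mu v == 0].
Proof. by rewrite !memv_cap !memv_ker andbA. Qed.
Let W'W v : v \in W' -> v \in W. Proof. by rewrite memW' => /and3P[]. Qed.
Let br_y0 u : u \in W -> lam u = 0 -> br u y = 0.
Proof. by move=> uW lu; rewrite br_y // -lamE lu scale0r. Qed.
Let W'y u : u \in W' -> br u y = 0.
Proof. by rewrite memW' => /and3P[uW /eqP lu _]; exact: br_y0. Qed.
Let f_W v : v \in W -> lam v = 0 -> f v \in W'.
Proof.
move=> vW lv; rewrite memW' fE memvB ?memvZ //=.
rewrite (linearB lam) (linearB mu) (linearZ_LR lam) (linearZ_LR mu) /= lv lam_y.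
by rewrite mu_y scaler0 subr0 /GRing.scale /= mulr1 subrr eqxx.
Qed.
(** The centralizer of [y] in [W] is an ideal: [br u y] is a multiple of [z], hence central, and the
    Jacobi identity applies. *)
Let lam_br u v : u \in W -> v \in W -> lam v = 0 -> lam (br u v) = 0.
Proof.
move=> uW vW lv; rewrite lamE (br_jacobi H) // (br_y0 vW lv) linear0 sub0r.
by rewrite (br_y uW) linearZ /= (z_central H) // scaler0 oppr0 linear0.
Qed.
Let br'E u v : br' u v = f (br u v). Proof. by rewrite comp_lfunE. Qed.
Let br'f u v : u \in W' -> br' u (f v) = f (br u v).
Proof. by move=> uW; rewrite br'E (fE v) linearB linearZ /= W'y // scaler0 subr0. Qed.
Let br'fl u v : v \in W' -> br' (f u) v = f (br u v).
Proof.
move=> vW; rewrite br'E (fE u) (brBl H) (brZl H) (br_skew H y) (W'y vW).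
by rewrite oppr0 scaler0 subr0.
Qed.

Lemma lie_data_step : lie_data W' br' xi z Rd.
Proof.
split.
- move=> c u v; apply/lfunP => w.
  rewrite add_lfunE scale_lfunE !br'E (brDl H) (brZl H) linearD linearZ //.
- by move=> u; rewrite br'E (br_alt H) linear0.
- move=> u v uW' vW'; rewrite br'E f_W //; first by rewrite (br_stab H) ?W'W.
  by apply: lam_br; rewrite ?W'W //; move: vW'; rewrite memW' => /and3P[_ /eqP].
- move=> u v w uW' vW' wW'; rewrite (br'E u v) br'fl // (br'E v w) (br'E u w).
  by rewrite !br'f // (br_jacobi H) ?W'W // linearB.
- have [m nilm] := br_nilp H; exists m => us v szus usW.
  (* The rule [br' u (f w) = f (br u w)] moves all reductions outside. The innermost [v] is not
     reduced, so the list must be nonempty, which [m.+1] ensures. *)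
  have -> : foldr (fun u w => br' u w) v us = f (foldr (fun u w => br u w) v us).
    elim: us m {nilm} szus usW => // u us IH m [szus] usW /=.
    case: us szus IH usW => [|u' us] szus IH usW; first by rewrite /= br'E.
    rewrite (IH (size us)) // ?br'f // ?usW ?mem_head // => w ws.
    by apply: usW; rewrite inE ws orbT.
  by rewrite nilm ?linear0 // => u /usW /W'W.
- by rewrite memW' (z_mem H) lam_z mu_z eqxx.
- by move=> u uW; rewrite br'E (z_central H) ?W'W // linear0.
- exact: xi_z H.
- move=> u uW' rad; apply: (br_rad H); first exact: W'W.
  (* Up to multiples of [x] and [y], [v] lies in [W']; the element [u] of [W'] is already orthogonal
     to both. *)
  move=> v vW; pose v0 := v - (lam v : K) *: x.
  have v0W : v0 \in W by rewrite memvB // memvZ.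
  have lv0 : lam v0 = 0.
    by rewrite linearB linearZ /= lam_x /GRing.scale /= mulr1 subrr.
  have E : br u v = br u v0 - (lam v : K) *: br x u.
    rewrite -scalerN -(br_skew H u x) -(linearZ_LR (br u)) -(linearD (br u)).
    by rewrite subrK.
  rewrite E linearB linearZ /= -muE -xi_f -br'f // (rad _ (f_W v0W lv0)) sub0r.
  by move: uW'; rewrite memW' => /and3P[_ _ /eqP->]; rewrite scaler0 oppr0.
Qed.

Lemma dim_step : (\dim W' < \dim W)%N.
Proof.
have sub : (W' <= W)%VS by apply/subvP => v; exact: W'W.
rewrite ltn_neqAle dimvS // andbT; apply/negP => /eqP eqd.
have /eqP WW : W' == W by rewrite eqEdim sub eqd leqnn.
by move: xW; rewrite -WW memW' lam_x oner_eq0 andbF.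
Qed.

Let siny0 : sin y != 0.
Proof.
by rewrite symalg_in_eq0; apply: contra_eq_neq mu_y => ->; rewrite linear0 eq_sym oner_eq0.
Qed.

Let ad_x_y : ad x (sin y) = sin z.
Proof. by rewrite der_lin_in br_xy. Qed.

(** The kernel of [ad x] is factorially closed and [ad x] sends [y] to [z], which is nonzero. Both
    the injectivity of the reduction and the invariance of the lift rest on this. *)
Let no_y q : ad x (sin y * q) = 0 -> q = 0.
Proof.
move=> Dq; apply/eqP/negPn/negP => q0.
have := der_factor char0 (ad_lnd H xW) Dq siny0 q0.
rewrite ad_x_y => /eqP; rewrite symalg_in_eq0; apply/negP; exact: z_neq0 H.
Qed.

Lemma step_inj a : invar W br a -> symalg_map f a = 0 -> a = 0.
Proof.
move=> [_ inva] fa; have [q aE] := symalg_map_mod a fE.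
rewrite fa add0r in aE; rewrite aE (no_y (q := q)) ?mulr0 //.
by rewrite -aE; exact: inva.
Qed.

(** The centralizer of [y] in [W], of codimension one with complement spanned by [x]; [f] maps it to
    [W']. *)
Let G := (W :&: lker lam)%VS.
Let memG v : (v \in G) = (v \in W) && (lam v == 0).
Proof. by rewrite memv_cap memv_ker. Qed.

Let G_lam nu a : symS W a -> {in G, forall v, nu v = 0} ->
  der (cst nu) a = (nu x : K) *: der (cst lam) a.
Proof.
move=> Wa nuG.
rewrite (der_eqW (G := fun v => (nu x : K) *: cst lam v) (cst_linear _) _ Wa).
- by rewrite /der scaler_sumr; apply: eq_bigr => i _; rewrite scalerAl.
- by move=> c u v; rewrite cst_linear scalerDr !scalerA mulrC.
move=> v vW; rewrite /cst -mul_mpolyC -mpolyCM; congr (_%:MP).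
have := nuG (v - (lam v : K) *: x); rewrite memG memvB ?memvZ //=.
rewrite (linearB lam) (linearB nu) (linearZ_LR lam) (linearZ_LR nu) /= lam_x.
rewrite {1}/GRing.scale /= mulr1 subrr eqxx.
by move=> /(_ isT)/eqP; rewrite subr_eq0 => /eqP->; rewrite /GRing.scale /= mulrC.
Qed.

(** On the subalgebra generated by [W], [ad y] is [- z] times the derivative along [lam], and [z]
    can be cancelled. *)
Let inv_G a : symS W a -> ad y a = 0 -> symS G a.
Proof.
move=> Wa ay nu nuG; rewrite G_lam //.
suff -> : der (cst lam) a = 0 by rewrite scaler0.
have : sin z * der (cst lam) a = 0.
  apply: oppr_inj; rewrite oppr0 -[RHS]ay.
  rewrite (der_eqW (G := fun v => - sin z * cst lam v) (lin_linear _) _ Wa).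
  - rewrite /der -mulNr mulr_sumr; apply: eq_bigr => i _.
    by rewrite mulrA.
  - by move=> c u v; rewrite cst_linear mulrDr scalerAr.
  move=> v vW; rewrite /lin (br_skew H) br_y // -lamE linearN linearZ /=.
  by rewrite /cst mulrC mul_mpolyC scalerN.
move=> /eqP; rewrite mulf_eq0 symalg_in_eq0 (negbTE (z_neq0 H)) => /eqP.
by [].
Qed.

Let ad_f u p : u \in W' -> der (lin (br' u)) (symalg_map f p) = symalg_map f (ad u p).
Proof.
move=> uW'; apply: symalg_map_der; try exact: lin_linear.
by move=> v; rewrite symalg_map_in /lin br'f.
Qed.

Lemma step_map a : invar W br a -> invar W' br' (symalg_map f a).
Proof.
move=> [Wa inva]; split=> [nu nuW'|u uW']; last first.
  by rewrite ad_f // inva ?W'W // rmorph0.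
rewrite (@symalg_map_der _ _ f (cst (nu \o f)%VF)); first 1 last.
- exact: cst_linear.
- exact: cst_linear.
- by move=> v; rewrite /cst symalg_mapC comp_lfunE.
rewrite (inv_G Wa _) ?rmorph0 //; first by exact: inva.
move=> v; rewrite memG => /andP[vW /eqP lv]; rewrite comp_lfunE nuW' //.
exact: f_W.
Qed.

(** The lift is killed by [ad x] through telescoping. For [u] in [G], [ad u] of the lift is a
    multiple of [y], and it vanishes by [no_y] once [ad x] is known to kill it. *)
Lemma step_lift t : invar W' br' t ->
  exists2 t', invar W br t' & exists N, symalg_map f t' = sin z ^+ N * t.
Proof.
move=> [W't invt].
have W'G : (W' <= G)%VS by exact: capvSl.
have GW : (G <= W)%VS by exact: capvSl.
have Gt := symS_sub W'G W't.
have ft : symalg_map f t = t.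
  apply: (symalg_map_fix char0 (lam := mu) (x := y)) => //.
  by apply: W't => w; rewrite memW' => /and3P[_ _ /eqP].
have [N DN] : exists N, iter N (ad x) t = 0.
  by apply: der_lnd; exact: (ad_lnd H xW).
have xG v : v \in G -> br x v \in G.
  rewrite !memG => /andP[vW /eqP lv]; rewrite (br_stab H) //=.
  by rewrite lam_br.
have GD n : symS G (iter n (ad x) t).
  by elim: n => //= n; apply: symS_der => v; exact: xG.
have yG : y \in G by rewrite memG yW lam_y eqxx.
have zG : z \in G by rewrite memG (z_mem H) lam_z eqxx.
(* The coefficients satisfy [cf n + (n + 1) cf (n + 1) = 0], which makes the sum telescope; [T n] is
   a partial sum and [T N] the lift. *)
pose cf n : K := (-1) ^+ n / n`!%:R.
pose T n := \sum_(i < n.+1) cf i *: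
  (sin y ^+ i * (sin z ^+ (N - i) * iter i (ad x) t)).
have adz u : u \in W -> ad u (sin z) = 0.
  by move=> uW; rewrite der_lin_in (z_central H) // linear0.
have adzX u n : u \in W -> ad u (sin z ^+ n) = 0.
  move=> uW; case: n => [|n]; first by rewrite expr0 -mpolyC1 derC.
  by rewrite derX adz // mulr0.
have DT n : (n <= N)%N -> ad x (T n) =
    cf n *: (sin y ^+ n * (sin z ^+ (N - n) * iter n.+1 (ad x) t)).
  elim: n => [|n IH] nN.
    by rewrite /T big_ord1 derZ expr0 !mul1r derM adzX // mul0r add0r.
  rewrite /T big_ord_recr raddfD /= IH ?(ltnW nN) // derZ derM derM adzX //.
  rewrite mul0r add0r scalerDr addrA -[RHS]add0r; congr (_ + _).
  rewrite derX ad_x_y -(subnSK nN) exprS.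
  set A := sin z ^+ (N - n.+1); set B := ad x (iter n (ad x) t).
  have -> : n.+1%:R * sin y ^+ n * sin z * (A * B) =
      (n.+1%:R : K) *: (sin y ^+ n * (sin z * A * B)).
    by rewrite -mul_mpolyC mpolyC_nat; ring.
  rewrite scalerA -scalerDl; suff -> : cf n + cf n.+1 * n.+1%:R = 0 by rewrite scale0r.
  have n0 := natS_neq0 char0 n.
  have nf : n`!%:R != 0 :> K.
    by case: n`! (fact_gt0 n) => // m _; exact: natS_neq0.
  rewrite /cf factS natrM exprS; move: (n.+1%:R) n0 (n`!%:R) nf => c c0 d d0.
  by field; rewrite c0 d0.
have Tx : ad x (T N) = 0 by rewrite DT //= DN raddf0 !mulr0 scaler0.
have GT : symS G (T N).
  rewrite /T; elim/big_ind: _ => [|p q|i _]; first by rewrite -mpolyC0; exact: symSC.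
    exact: symSD.
  rewrite -mul_mpolyC; apply: symSM; first exact: symSC.
  by apply: symSM; [|apply: symSM]; rewrite ?GD //; apply/symSX/symS_in.
have WT := symS_sub GW GT.
have adyG p : symS G p -> ad y p = 0.
  move=> Gp; rewrite (der_eqW (G := fun => 0) (lin_linear _) _ Gp).
  - by rewrite /der big1 // => i _; rewrite mul0r.
  - by move=> c u v; rewrite scaler0 addr0.
  move=> v; rewrite memG => /andP[vW /eqP lv].
  by rewrite /lin (br_skew H) br_y0 // oppr0 linear0.
(* Modulo [y] only the term with [i = 0] remains, and there [u] acts as [f u], an element of [W'],
   which kills [t] modulo [y]. *)
have ydvd u : u \in G -> exists q, ad u (T N) = sin y * q.
  rewrite memG => /andP[uW /eqP lu].
  have ydvdt : exists q, ad u t = sin y * q.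
    have -> : u = f u + (mu u : K) *: y by rewrite fE subrK.
    have fuW : f u \in W' by exact: f_W.
    rewrite (adD H) (adZ H) (adyG t) // scaler0 addr0.
    have [q ->] := symalg_map_mod (ad (f u) t) fE; exists q.
    by rewrite -ad_f // ft invt // add0r.
  have adyk n : ad u (sin y ^+ n) = 0.
    case: n => [|n]; first by rewrite expr0 -mpolyC1 derC.
    by rewrite derX der_lin_in br_y0 // linear0 mulr0.
  rewrite /T raddf_sum /=; elim/big_ind: _ => [|_ _ [p ->] [q ->]|i _].
  - by exists 0; rewrite mulr0.
  - by exists (p + q); rewrite mulrDr.
  rewrite derZ derM adyk mul0r add0r; case: (nat_of_ord i) => [|j].
    have [q E] := ydvdt; rewrite derM /= adzX // E mul0r add0r.
    by exists (cf 0%N *: (sin z ^+ (N - 0) * q)); rewrite expr0 mul1r -!mul_mpolyC; ring.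
  by eexists; rewrite exprS -mulrA scalerAr.
have adG u : u \in G -> ad u (T N) = 0.
  (* Induction on the [n] with [(br x)^n u = 0]: since [ad x] kills [T N], [ad x (ad u (T N))]
     equals [ad (br x u) (T N)], which is zero by induction. *)
  have [n nilx] := br_nil H xW.
  move: {nilx}(nilx u); elim: n u => [|n IH] u.
    by move=> /= -> _; rewrite /der big1 // => i _; rewrite /lin (br0l H) linear0 mul0r.
  rewrite iterSr => nu uG; have [q E] := ydvd u uG.
  have uW := subvP GW _ uG.
  rewrite E (no_y (q := q)) ?mulr0 // -E (ad_comm H) // Tx raddf0 add0r.
  by apply: IH => //; exact: xG.
exists (T N).
  split=> // u uW; have -> : u = (u - (lam u : K) *: x) + (lam u : K) *: x by rewrite subrK.
  rewrite (adD H) (adZ H) Tx scaler0 addr0 adG // memG memvB ?memvZ //=.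
  by rewrite linearB linearZ /= lam_x /GRing.scale /= mulr1 subrr.
exists N; rewrite /T rmorph_sum /= big_ord_recl big1 ?addr0 => [|i _].
  rewrite symalg_mapZ !rmorphM !rmorphXn /= !symalg_map_in f_z ft subn0.
  by rewrite /cf expr0 fact0 divr1 scale1r expr0 mul1r.
by rewrite symalg_mapZ rmorphM rmorphXn /= symalg_map_in f_y linear0 exprS !mul0r scaler0.
Qed.

End Step.

(* With [Z = 0] this is the center, with [Z] the center the second center. *)
Lemma relative_center (W Z : {vspace L}) (br : L -> 'End(L)) v :
  {in W &, forall u w, br u w \in W} ->
  (exists m, forall us w, size us = m.+1 -> {subset us <= W} ->
    foldr (fun u w => br u w) w us = 0) ->
  v \in W -> v \notin Z ->
  exists2 y, y \in W /\ y \notin Z & {in W, forall u, br u y \in Z}.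
Proof.
move=> stab [m nilm] vW vz.
have {nilm} : forall us, size us = m.+1 -> {subset us <= W} ->
    foldr (fun u w => br u w) v us \in Z.
  by move=> us szus usW; rewrite nilm ?mem0v.
elim: m v vW vz => [|m IH] v vW vz nilm.
  exists v => // u uW; apply: (nilm [:: u]) => // w.
  by rewrite inE => /eqP->.
(* If some [br u v] lies outside [Z], it replaces [v] and words one letter shorter suffice;
   otherwise [v] itself is the witness. *)
have [[u [uW uz]]|noU] := pselect (exists u, u \in W /\ br u v \notin Z).
  apply: (IH (br u v)) => //; first exact: stab.
  move=> us szus usW; rewrite -[br u v]/(foldr (fun u w => br u w) v [:: u]) -foldr_cat.
  apply: nilm => [|w]; first by rewrite size_cat szus addn1.
  by rewrite mem_cat inE => /orP[/usW//|/eqP->].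
exists v => // u uW; apply: contrapT => uz; apply: noU; exists u; split=> //.
exact/negP.
Qed.

(** Induction on the dimension of [W]; [xi], [z] and [Rd] stay the same through all reductions. *)
Lemma invar_loc (W : {vspace L}) br xi z Rd :
  lie_data W br xi z Rd -> (\dim Rd <= 2)%N ->
  exists2 t, invar W br t & forall a, invar W br a -> loc (sin z) t a.
Proof.
move=> + dimR; have [n] := ubnP (\dim W); elim: n W br => // n IH W br ltWn H.
have z0 := z_neq0 H.
have base w : w \in W -> {in W, forall u, br u w = 0} ->
  {in W, forall u, {in W, forall v, xi (br u v) = 0} -> u \in (<[z]> + <[w]>)%VS} ->
  exists2 t, invar W br t & forall a, invar W br a -> loc (sin z) t a.
  move=> wW wc rad; exists (sin w); first exact: invar_center.
  by move=> a inva; apply/alg_loc/(invar_base char0 H wW wc rad).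
have [[w [wW wc wz]]|noW] := pselect (exists w, [/\ w \in W,
    {in W, forall u, br u w = 0} & w \notin <[z]>%VS]).
  apply: (base w) => // u uW ru.
  (* Central vectors lie in the radical, hence in [Rd]; as [z] and [w] are independent and [Rd] has
     dimension at most 2, they span it. *)
  suff <- : Rd = (<[z]> + <[w]>)%VS by exact: (br_rad H).
  apply/esym/eqP; rewrite eqEdim subv_add -!memvE; apply/andP; split.
    apply/andP; split; apply: (br_rad H) => //; first exact: (z_mem H).
      by move=> v vW; rewrite (br_skew H) (z_central H) // oppr0 linear0.
    by move=> v vW; rewrite (br_skew H) wc // oppr0 linear0.
  apply: leq_trans dimR _; rewrite dimv_disjoint_sum.
    rewrite !dim_vline z0; case: eqP wz => // ->; by rewrite mem0v.
  apply/eqP; rewrite -subv0; apply/subvP => v; rewrite memv_cap memv0.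
  move=> /andP[/vlineP[b ->] /vlineP[c E]]; apply/eqP.
  case: (eqVneq c 0) => [c0|c0]; first by rewrite E c0 scale0r.
  case/negP: wz; apply/vlineP; exists (c^-1 * b).
  by rewrite -scalerA E scalerA mulVf // scale1r.
have [Wz|/subvPn[v vW vz]] := boolP (W <= <[z]>)%VS.
  apply: (base z) => [||u uW _]; [exact: (z_mem H)|exact: (z_central H)|].
  by rewrite addvv; exact: (subvP Wz).
have [y0 [y0W y0z] y0c] := relative_center (br_stab H) (br_nilp H) vW vz.
(* Subtracting a multiple of [z] gives [xi y = 0] and changes no [br u y] with [u] in [W]. *)
pose y := y0 - (xi y0 : K) *: z.
have yW : y \in W by rewrite memvB // memvZ // (z_mem H).
have yz : y \notin <[z]>%VS.
  apply: contra y0z => yz; rewrite -(subrK ((xi y0 : K) *: z) y0).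
  by rewrite memvD // memvZ // memv_line.
have xi_y : xi y = 0.
  by rewrite linearB linearZ /= (xi_z H) /GRing.scale /= mulr1 subrr.
have br_y : {in W, forall u, br u y = (xi (br u y) : K) *: z}.
  move=> u uW; have -> : br u y = br u y0.
    by rewrite linearB linearZ /= (z_central H) // scaler0 subr0.
  have /vlineP[c ->] := y0c u uW.
  by rewrite linearZ /= (xi_z H) /GRing.scale /= mulr1.
(* A central [y] would contradict [noW], so some [br u y] is a nonzero multiple of [z], and [u] can
   be rescaled. *)
have [x xW br_xy] : exists2 x, x \in W & br x y = z.
  have [[u [uW uy]]|noU] := pselect (exists u, u \in W /\ br u y != 0); last first.
    case: noW; exists y; split=> // u uW; apply: contrapT => /eqP uy.
    by apply: noU; exists u.
  pose c : K := xi (br u y).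
  have c0 : c != 0 by apply: contra uy => /eqP c0; rewrite br_y // -/c c0 scale0r.
  exists (c^-1 *: u); first exact: memvZ.
  by rewrite (brZl H) br_y // -/c scalerA mulVf // scale1r.
have H' := lie_data_step H xW yW xi_y br_xy br_y.
have ltW' := dim_step H xW br_xy.
have [t' invt' genW'] := IH _ _ (leq_trans ltW' ltWn) H'.
have [t invt [N ft]] := step_lift H xW yW br_xy br_y invt'.
exists t => // a inva.
have := genW' _ (step_map H xW yW br_xy br_y inva).
move=> /(loc_trans (t' := sin z ^+ N * t')) [|m [P Pm]].
  by exists N; exact: alg_r.
exists m, P.
pose f := shear (xi \o br x)%VF y.
have fz : symalg_map f (sin z) = sin z.
  rewrite symalg_map_in shearE comp_lfunE (z_central H) //.
  by rewrite (linear0 xi) scale0r subr0.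
have fP Q : symalg_map f (gen2 (sin z) t Q) = gen2 (sin z) (sin z ^+ N * t') Q.
  elim/mpolyind: Q => [|c mm Q _ _ IHQ]; first by rewrite !raddf0.
  rewrite !rmorphD /= IHQ -mul_mpolyC !rmorphM /= !gen2C symalg_mapC.
  congr (_ * _ + _); rewrite mpolyXE_id !rmorph_prod; apply: eq_bigr => i _ /=.
  rewrite !rmorphXn /= /gen2 !mmapX !mmap1U; case: ifP => _; last by rewrite -ft.
  by rewrite fz.
(* The relation holds after reduction modulo [y], and both of its sides are invariants, on which the
   reduction is injective. *)
apply/eqP; rewrite -subr_eq0; apply/eqP.
apply: (step_inj H xW br_xy).
  have iz := invar_z H.
  have i1 : invar W br (gen2 (sin z) t P) by apply: (invar_alg iz invt); exists P.
  have iM p q : invar W br p -> invar W br q -> invar W br (p * q).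
    move=> ip iq; apply: (invar_alg ip iq); apply: algM; [exact: alg_l|exact: alg_r].
  have i2 : invar W br (sin z ^+ m * a).
    by apply: (invar_alg iz inva); apply: algM; [apply/algX/alg_l|exact: alg_r].
  apply: (invar_alg i1 i2); rewrite -mulN1r; apply: algD; first exact: alg_l.
  apply: algM; last exact: alg_r.
  by rewrite -mpolyC1 -mpolyCN; exact: alg_const.
rewrite rmorphB /= fP Pm rmorphM rmorphXn /= fz subrr //.
Qed.

End Reduction.

(** * Polynomial generators *)

Section Generation.
Variables (K : closedFieldType) (n : nat).
Local Notation S := {mpoly K[n]}.

(** Over an algebraically closed field [p] splits into linear factors, and in a domain one of the
    factors [s - c] would have to vanish. *)
Lemma closed_transcendental (s : S) (p : {poly K}) : (forall c, s != c%:MP) ->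
  (map_poly (@mpolyC n K) p).[s] = 0 -> p = 0.
Proof.
move=> sc ps; apply/eqP/negPn/negP => p0.
have [r pE] := closed_field_poly_normal p; move: ps; rewrite pE.
rewrite linearZ /= rmorph_prod hornerZ horner_prod => /eqP.
rewrite mulf_eq0 mpolyC_eq0 lead_coef_eq0 (negbTE p0) prodf_seq_eq0 /=.
case/hasP => c _; rewrite /= rmorphB /= map_polyX map_polyC /= hornerXsubC.
by rewrite subr_eq0 (negbTE (sc c)).
Qed.

Section Hom.
Variables (m : nat) (h : 'I_m -> S).

Definition hom : {mpoly K[m]} -> S := mmap (@mpolyC n K) h.
HB.instance Definition _ := GRing.RMorphism.on hom.
Fact hom_scalable : scalable hom.
Proof. by move=> c p; rewrite /hom mmapZ mul_mpolyC. Qed.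
HB.instance Definition _ :=
  GRing.isScalable.Build K {mpoly K[m]} S *:%R hom hom_scalable.

Variables (rho : {rmorphism S -> S}) (i : 'I_m).
Hypotheses (hi0 : h i != 0) (rho_hi : rho (h i) = 0).
Hypothesis rho_ker : forall P, rho (hom P) = 0 -> exists Q, P = 'X_i * Q.

Lemma homX : hom 'X_i = h i.
Proof. by rewrite /hom mmapX mmap1U. Qed.

(** A relation [P] is divisible by ['X_i] by [rho_ker]; cancelling [h i] gives a relation of smaller
    degree. *)
Lemma hom_inj : injective hom.
Proof.
apply: raddf_inj => P; have [l] := ubnP (msize P); elim: l P => // l IH P szP P0.
have [Q PE] : exists Q, P = 'X_i * Q by apply: rho_ker; rewrite P0 rmorph0.
case: (eqVneq Q 0) => [Q0|Q0]; first by rewrite PE Q0 mulr0.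
have X0 : 'X_i != 0 :> {mpoly K[m]} by rewrite -msize_poly_eq0 msizeX.
rewrite PE (IH Q) ?mulr0 //.
  by move: szP; rewrite PE msizeM // msizeX mdeg1 /=.
move: P0; rewrite PE /= rmorphM /= homX => /eqP; rewrite mulf_eq0 (negbTE hi0).
by move/eqP.
Qed.

(** The image is saturated with respect to [h i]: one factor [h i] is divided out at a time, using
    [rho_ker]. *)
Lemma hom_sat l a P : hom P = h i ^+ l * a -> exists Q, hom Q = a.
Proof.
elim: l P => [|l IH] P; first by rewrite mul1r => <-; exists P.
move=> E; have [Q PE] : exists Q, P = 'X_i * Q.
  by apply: rho_ker; rewrite E rmorphM rmorphXn /= rho_hi exprS !mul0r.
apply: (IH Q); apply: (mulfI hi0).
by rewrite mulrA -exprS -E PE rmorphM /= homX.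
Qed.

End Hom.

Lemma mpoly1_split (P : {mpoly K[1]}) : exists Q c, P = 'X_ord0 * Q + c%:MP.
Proof.
elim/mpolyind: P => [|c m p _ _ [Q [d ->]]].
  by exists 0, 0; rewrite mulr0 mpolyC0 addr0.
rewrite mpolyXE_id big_ord1; case: (m ord0) => [|l].
  by exists Q, (c + d); rewrite expr0 mpolyCD -mul_mpolyC; ring.
by exists (c *: 'X_ord0 ^+ l + Q), d; rewrite exprS -!mul_mpolyC; ring.
Qed.

(** The part free of the first variable is kept as a univariate polynomial, the form needed by
    [closed_transcendental]. *)
Lemma mpoly2_split (P : {mpoly K[2]}) :
  exists Q (p : {poly K}),
    P = 'X_ord0 * Q + (map_poly (@mpolyC 2 K) p).['X_ord_max].
Proof.
elim/mpolyind: P => [|c m p _ _ [Q [d ->]]].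
  by exists 0, 0; rewrite map_poly0 horner0 mulr0 addr0.
rewrite mpolyXE_id big_ord_recl big_ord1; case: (m ord0) => [|l].
  exists Q, (c *: 'X^(m ord_max) + d).
  rewrite rmorphD /= linearZ /= map_polyXn hornerD hornerZ hornerXn.
  have -> : lift ord0 ord0 = ord_max :> 'I_2 by exact: val_inj.
  by rewrite expr0 -!mul_mpolyC; ring.
exists (c *: ('X_ord0 ^+ l * 'X_(lift ord0 ord0) ^+ m (lift ord0 ord0)) + Q), d.
by rewrite exprS -!mul_mpolyC; ring.
Qed.

End Generation.

(** * Initial bracket data, a generic functional and the choice of the second generator *)

Section Final.
Variables (K : closedFieldType) (L : lieAlgType K).
Local Notation S := {mpoly K[\dim {:L}]}.
Local Notation sin := (@symalg_in K L).

Definition adl (u : L) : 'End(L) := linfun (lie u).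

Lemma adlE u v : adl u v = [lie u, v]. Proof. exact: lfunE. Qed.

Lemma adl_linear : linear adl.
Proof.
move=> c u v; apply/lfunP => w.
by rewrite add_lfunE scale_lfunE !adlE lieDl lieZl.
Qed.

Lemma adl_jacobi u v w : adl (adl u v) w = adl u (adl v w) - adl v (adl u w).
Proof.
rewrite !adlE (lieC [lie u, v] w) (lieC u w) linearN /= opprK.
by have /eqP := lie_jacobi u v w; rewrite addr_eq0 => /eqP->.
Qed.

Lemma adl_nilp : lie_nilpotent L -> exists m, forall us v, size us = m.+1 ->
  {subset us <= {:L}%VS} -> foldr (fun u w => adl u w) v us = 0.
Proof.
move=> [m nilm]; exists m => us v szus _.
have mem (s : seq L) : foldr (fun u w => adl u w) v s \in lower_central L (size s).
  elim: s => [|u s IH] /=; first exact: memvf.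
  by rewrite adlE memv_lie ?memvf.
case: us szus => // u us [szus] /=.
have := mem us; rewrite szus nilm memv0 => /eqP->.
exact: linear0.
Qed.

Lemma lie_invariantE a : lie_invariant a <-> invar {:L}%VS adl a.
Proof.
have E u : symalg_ad u a = der (lin (adl u)) a.
  by apply: eq_bigr => i _; rewrite /lin adlE.
split=> [inva|[_ inva] u]; last by rewrite E inva ?memvf.
by split=> [|u _]; [exact: symS_full|rewrite -E inva].
Qed.

(** On the line [xi + s eta] with [eta z = 1], all but finitely many [s] keep the form nondegenerate
    on a complement of the stabilizer of [xi] and make the value at [z] nonzero. *)
Lemma generic_form (z : L) (xi : 'Hom(L, K^o)) : z != 0 ->
  exists2 nu : 'Hom(L, K^o), nu z != 0 &
    (\dim (lie_stab nu) <= \dim (lie_stab xi))%N.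
Proof.
move=> z0; pose eta := coordf [tuple z] ord0 \1%VF.
have eta_z : eta z = 1.
  rewrite coordfE id_lfunE.
  have := @coord_free _ _ _ [tuple z] ord0 ord0.
  by rewrite eqxx /= seq1_free; apply.
set C := ((lie_stab xi)^C)%VS; set c := vbasis C.
have cvR n (v : 'rV[K]_n) (w : 'I_n -> L) (nu : 'Hom(L, K^o)) y :
    nu [lie \sum_i v 0 i *: w i, y] = \sum_i v 0 i * nu [lie w i, y] :> K.
  rewrite lie_suml linear_sum; apply: eq_bigr => i _.
  by rewrite lieZl linearZ.
have cC (v : 'rV_(\dim C)) : \sum_i v 0 i *: c`_i \in C.
  by apply: memv_suml => i _; rewrite memvZ // vbasis_mem // mem_nth ?size_tuple.
pose A (nu : 'Hom(L, K^o)) : 'M[K]_(\dim C) :=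
  \matrix_(i, j) (nu [lie c`_i, c`_j] : K).
(* A vector in the left kernel would give an element of [C] orthogonal to [C] and to the radical,
   hence in the radical. *)
have detA : \det (A xi) != 0.
  apply/negP => /det0P[v v0 vA]; case/eqP: v0.
  have vs : \sum_i v 0 i *: c`_i \in lie_stab xi.
    apply/lie_stabP => y.
    have yd : y \in (C + lie_stab xi)%VS by rewrite addvC addv_complf memvf.
    have [y1 y1C [y2 y2s ->]] := memv_addP yd.
    rewrite linearD linearD /= (lieC _ y2) linearN /=.
    have /lie_stabP-> := y2s.
    rewrite (coord_vbasis y1C) linear_sum linear_sum big1 ?oppr0 ?addr0 // => j _.
    rewrite !linearZ /= cvR; have := congr1 (fun M : 'rV_ _ => M 0 j) vA.
    rewrite !mxE => E; rewrite (_ : \sum_i _ = 0) ?scaler0 // -[RHS]E.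
    by apply: eq_bigr => i _; rewrite mxE.
  have : \sum_i v 0 i *: c`_i \in (lie_stab xi :&: C)%VS by rewrite memv_cap vs cC.
  rewrite capv_compl memv0 => /eqP v0; apply/rowP => i; rewrite mxE.
  by have /freeP := basis_free (vbasisP C); apply.
pose P : {poly K} := \det (map_mx polyC (A xi) + 'X *: map_mx polyC (A eta)).
have PE s : P.[s] = \det (A (xi + s *: eta)).
  rewrite -[LHS]/(horner_eval s P) -det_map_mx; congr (\det _).
  apply/matrixP => i j; rewrite !mxE /= /horner_eval hornerD hornerM !hornerC hornerX.
  by rewrite add_lfunE scale_lfunE.
have P0 : P != 0.
  by apply: contraNneq detA => P0; rewrite -[xi]addr0 -(scale0r eta) -PE P0 horner0.
(* The linear factor excludes the one [s] at which the new functional vanishes on [z]. *)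
have PX0 : ('X - (- xi z : K)%:P) * P != 0 by rewrite mulf_neq0 // polyXsubC_eq0.
have /closed_nonrootP[s] := PX0.
rewrite rootM root_XsubC negb_or => /andP[sz Ps]; exists (xi + s *: eta).
  rewrite add_lfunE scale_lfunE eta_z /GRing.scale /= mulr1 addrC.
  by rewrite -[xi z]opprK subr_eq0.
set st := lie_stab (xi + s *: eta).
(* The new stabilizer meets [C] trivially, which bounds its dimension by the codimension of [C]. *)
have cap0 : (st :&: C = 0)%VS.
  apply/eqP; rewrite -subv0; apply/subvP => u; rewrite memv_cap memv0.
  case/andP => /lie_stabP us uC.
  pose v : 'rV_(\dim C) := \row_i coord c i u.
  have uE : u = \sum_i v 0 i *: c`_i.
    by rewrite {1}(coord_vbasis uC); apply: eq_bigr => i _; rewrite mxE.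
  have vA : v *m A (xi + s *: eta) = 0.
    apply/rowP => j; rewrite !mxE -[RHS](us c`_j) {1}uE cvR.
    by apply: eq_bigr => i _; rewrite [A _ _ _]mxE.
  have v0 : v = 0.
    apply/eqP/negPn/negP => v0; case/negP: Ps; rewrite /root PE.
    by apply/det0P; exists v.
  by rewrite uE v0 big1 // => i _; rewrite mxE scale0r.
have := dimvS (subvf (st + C)%VS).
rewrite (dimv_disjoint_sum cap0) [\dim C]dimv_compl => H.
have le : (\dim (lie_stab xi) <= \dim {:L})%N := dimvS (subvf _).
by rewrite -(leq_add2r (\dim {:L} - \dim (lie_stab xi))%N) (subnKC le).
Qed.

Lemma lie_data_exists : lie_nilpotent L -> (lie_index L <= 2)%N ->
  {:L}%VS != 0%VS ->
  exists xi z Rd, lie_data {:L}%VS adl xi z Rd /\ (\dim Rd <= 2)%N.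
Proof.
move=> nilL ind2 L0.
have nil := adl_nilp nilL.
have [z0 [_ z0n] z0c] : exists2 z, z \in {:L}%VS /\ z \notin 0%VS &
    {in {:L}%VS, forall u, adl u z \in 0%VS}.
  have v0 : vpick {:L}%VS \notin 0%VS by rewrite memv0 vpick0.
  by apply: relative_center nil (memvf _) v0 => u v _ _; exact: memvf.
rewrite memv0 in z0n.
have [xi0 dxi0] : exists xi0 : 'Hom(L, K^o), (\dim (lie_stab xi0) <= 2)%N.
  move: ind2; rewrite /lie_index; case: ex_minnP => d /asboolP[xi0 <-] _ le2.
  by exists xi0.
have [xi xiz dxi] := generic_form xi0 z0n.
(* Rescaling gives [xi z = 1], and the radical of the form is the stabilizer itself. *)
exists xi, ((xi z0 : K)^-1 *: z0), (lie_stab xi); split; last exact: leq_trans dxi0.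
split=> //; rewrite ?memvf //.
- exact: adl_linear.
- by move=> u; rewrite adlE liexx.
- by move=> *; exact: memvf.
- by move=> u v w _ _ _; exact: adl_jacobi.
- move=> u _; rewrite linearZ /=; have := z0c u (memvf u).
  by rewrite memv0 => /eqP->; rewrite scaler0.
- by rewrite linearZ /= /GRing.scale /= mulVf.
- by move=> u _ ru; apply/lie_stabP => v; rewrite -adlE ru ?memvf.
Qed.

(** Here [rho] is reduction modulo [z]. If [t = c + z q] with [q] nonzero, then [q] is again
    invariant because [z] is invariant and can be cancelled, and the degree drops. *)
Lemma good_generator (W : {vspace L}) br xi z Rd (rho := symalg_map (shear xi z)) t :
  lie_data W br xi z Rd ->
  invar W br t -> (forall a, invar W br a -> loc (sin z) t a) ->
  (exists c, forall a, invar W br a -> loc (sin z) c%:MP a) \/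
  exists t', [/\ invar W br t', forall c, rho t' != c%:MP &
    forall a, invar W br a -> loc (sin z) t' a].
Proof.
move=> H; have [l] := ubnP (msize t); elim: l t => // l IH t szt invt gent.
have z0 : sin z != 0 by rewrite symalg_in_eq0 (z_neq0 H).
have [[c rc]|norc] := pselect (exists c, rho t = c%:MP); last first.
  by right; exists t; split=> // c; apply/eqP => rc; apply: norc; exists c.
have [q] := symalg_map_mod t (shearE xi z); rewrite -/rho rc => tE.
case: (eqVneq q 0) => [q0|q0].
  by left; exists c => a /gent; rewrite {1}tE q0 mulr0 addr0.
have invq : invar W br q.
  split=> [lam lamW|u uW].
    have := invt.1 lam lamW; rewrite tE raddfD /= derC add0r derM.
    rewrite (symS_in (z_mem H)) // mul0r add0r => /eqP.
    by rewrite mulf_eq0 (negbTE z0) => /eqP.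
  have := invt.2 u uW; rewrite tE raddfD /= derC add0r derM.
  rewrite (invar_z H).2 // mul0r add0r => /eqP.
  by rewrite mulf_eq0 (negbTE z0) => /eqP.
apply: (IH q) => // [|a /gent].
  have szz : (1 < msize (sin z))%N.
    rewrite ltnNge; apply/negP => /msize1_polyC zC.
    have := der_cst_in xi z; rewrite zC derC (xi_z H) => /eqP.
    by rewrite eq_sym mpolyC_eq0 oner_eq0.
  have : (msize (sin z * q) <= maxn (msize t) (msize ((- c)%:MP : S)))%N.
    have -> : sin z * q = t + (- c)%:MP by rewrite [in RHS]tE mpolyCN addrC addKr.
    exact: msizeD_le.
  rewrite msizeM // msizeC => le0.
  have le : (msize q < maxn (msize t) (- c != 0)%R)%N.
    apply: leq_trans le0; case: (msize (sin z)) szz => [|[|s]] // _.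
    by rewrite !addSn /= ltnS leq_addl.
  (* The constant contributes at most 1 to the maximum, so a bound coming from it would force
     [msize q = 0]. *)
  have q1 : (0 < msize q)%N by rewrite lt0n msize_poly_eq0.
  move: le; rewrite leq_max => /orP[le|]; first exact: leq_trans le szt.
  by move=> /leq_trans/(_ (leq_b1 _)); rewrite ltnS leqNgt q1.
apply: loc_trans; apply: alg_loc; rewrite tE; apply: algD; first exact: alg_const.
by apply: algM; [exact: alg_l|exact: alg_r].
Qed.

End Final.

Lemma invar_hom (K : closedFieldType) (L : lieAlgType K) W br m
    (h : 'I_m -> {mpoly K[\dim {:L}]}) P :
  (forall i, invar W br (h i)) -> invar W br (hom h P).
Proof.
move=> invh; have invC c : invar W br (c%:MP : {mpoly K[\dim {:L}]}).
  by split=> [|u _]; [exact: symSC|rewrite derC].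
have invM a b : invar W br a -> invar W br b -> invar W br (a * b).
  by move=> ia ib; apply: (invar_alg ia ib); apply: algM; [exact: alg_l|exact: alg_r].
elim/mpolyind: P => [|c mm p _ _ IH]; first by rewrite raddf0 -mpolyC0.
have inv1 : invar W br (hom h (c *: 'X_[mm])).
  rewrite /hom mmapZ mmapX /mmap1; apply: (invM); first exact: invC.
  apply: (big_ind (invar W br)) => [||i _] //=; first by rewrite -mpolyC1; exact: invC.
  apply: (invar_alg (invh i) (invh i)); exact/algX/alg_l.
rewrite rmorphD; apply: (invar_alg inv1 IH); apply: algD; [exact: alg_l|exact: alg_r].
Qed.

Theorem theorem45 (k : closedFieldType) (char0 : [pchar k] =i pred0)
    (g : lieAlgType k) (nilp : lie_nilpotent g) (index_le2 : (lie_index g <= 2)%N) :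
  coregular g.
Proof.
have [/eqP g0|g0] := boolP ({:g}%VS == 0%VS).
  (* For the zero algebra the adjoint action is an empty sum, so every element is invariant. *)
  exists (\dim {:g}), idfun; split=> // p; split=> [_|_ x]; first by exists p.
  rewrite /symalg_ad big1 // => i _.
  have d0 : \dim {:g} = 0%N by rewrite g0 dimv0.
  by have : (i < 0)%N by rewrite -d0.
have [xi [z [Rd [H dimR]]]] := lie_data_exists nilp index_le2 g0.
have [t0 invt0 gent0] := invar_loc char0 H dimR.
have z0 : symalg_in z != 0 by rewrite symalg_in_eq0 (z_neq0 H).
pose rho := symalg_map (shear xi z).
have rho_z : rho (symalg_in z) = 0.
  by rewrite /rho symalg_map_in shearE (xi_z H) scale1r subrr linear0.
(* Both cases end here: the last hypothesis says that the generators other than [z] are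
   algebraically independent modulo [z]. *)
have conclude m (h : 'I_m -> symalg g) (i : 'I_m) t : h i = symalg_in z ->
    (exists P, hom h P = t) ->
    (forall a, invar {:g}%VS (@adl k g) a -> loc (symalg_in z) t a) ->
    (forall j, invar {:g}%VS (@adl k g) (h j)) ->
    (forall P, rho (hom h P) = 0 -> exists Q, P = 'X_i * Q) -> coregular g.
  move=> hi ht gent invh ker; exists m, (hom h).
  have hi0 : h i != 0 by rewrite hi.
  have rho_hi : rho (h i) = 0 by rewrite hi.
  split=> [|p]; first exact: hom_inj ker.
  rewrite lie_invariantE; split=> [/gent[l Pl]|[q <-]].
    have [P PE] : exists P, hom h P = symalg_in z ^+ l * p.
      move: Pl; apply: (alg_ind (P := fun a => exists P, hom h P = a))
        => [c||//|a b [P <-] [Q <-]|a b [P <-] [Q <-]].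
      - by exists c%:MP; rewrite /hom mmapC.
      - by exists 'X_i; rewrite homX.
      - by exists (P + Q); rewrite rmorphD.
      - by exists (P * Q); rewrite rmorphM.
    by apply: (hom_sat hi0 rho_hi ker (l := l) (P := P)); rewrite hi.
  exact: invar_hom.
have [[c genc]|[t [invt rt gent]]] := good_generator H invt0 gent0.
  (* With a constant [t], [z] alone generates. *)
  apply: (conclude 1%N (fun=> symalg_in z) ord0 c%:MP) => //.
  - by exists c%:MP; rewrite /hom mmapC.
  - by move=> _; exact: invar_z H.
  move=> P; have [Q [d ->]] := mpoly1_split P.
  rewrite /rho /= rmorphD rmorphM /= homX [hom _ d%:MP]mmapC.
  rewrite rmorphD rmorphM /= -/rho rho_z.
  rewrite mul0r add0r /rho symalg_mapC => /eqP; rewrite mpolyC_eq0 => /eqP->.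
  by exists Q; rewrite mpolyC0 addr0.
pose h (i : 'I_2) := if i == ord0 then symalg_in z else t.
apply: (conclude 2%N h ord0 t) => //.
- by exists 'X_ord_max; rewrite homX.
- by move=> i; rewrite /h; case: ifP => _ //; exact: invar_z H.
move=> P; have [Q [p ->]] := mpoly2_split P.
rewrite /rho /= rmorphD rmorphM /= homX rmorphD rmorphM /= -/rho rho_z mul0r add0r => pr.
(* Reduction modulo [z] leaves [p] evaluated at [rho t], which is not a constant and therefore
   transcendental. *)
suff -> : p = 0 by exists Q; rewrite map_poly0 horner0 addr0.
apply: (closed_transcendental rt).
rewrite -[RHS]pr /rho -[hom h _.[_]]horner_map -[RHS]horner_map /=.
rewrite homX -!map_poly_comp; congr (_.[_]); apply: eq_map_poly => d.
by rewrite /= [hom _ _]mmapC /rho symalg_mapC.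
Qed.
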